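(* Let $H$ be a complex Hilbert space and let $\phi: C_1^+(H)\to C_1^+(H)$ be a bijective map (not assumed to be linear or affine in any sense) which preserves the Bures distance, that is, $$d_b(\phi(A),\phi(B))=d_b(A,B)\qquad (A,B\in C_1^+(H)).$$ Then there is an either unitary or antiunitary operator $U$ on $H$ such that $$\phi(A)=UAU^*\qquad (A\in C_1^+(H)).$$
   Context: $H$ is a complex Hilbert space (of arbitrary dimension). $C_1(H)$ denotes the set of all trace-class operators on $H$, i.e. bounded linear operators whose absolute value has finite trace, and $\operatorname{tr}$ is the trace functional. $C_1^+(H)$ is the set of all positive (i.e. positive semidefinite, including $0$) trace-class operators on $H$. For $A,B\in C_1^+(H)$ the fidelity is $F(A,B)=\operatorname{tr}\big((A^{1/2}BA^{1/2})^{1/2}\big)$, and the Bures metric is $$d_b(A,B)=(\operatorname{tr}A+\operatorname{tr}B-2F(A,B))^{1/2}.$$ An antiunitary operator on $H$ is a conjugate-linear bijection $U:H\to H$ with $\langle Ux,Uy\rangle=\overline{\langle x,y\rangle}$ for all $x,y\in H$; its adjoint is $U^*=U^{-1}$ (as for unitary operators). *)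

(* Defs.v *)
From mathcomp Require Import all_boot all_order all_algebra.
From mathcomp Require Import complex.
From mathcomp Require Import all_classical all_reals all_analysis.

Set Implicit Arguments.
Unset Strict Implicit.
Unset Printing Implicit Defensive.

Import Order.TTheory GRing.Theory Num.Theory.
Import numFieldNormedType.Exports.

Local Open Scope classical_set_scope.
Local Open Scope ring_scope.

(* A complex Hilbert space is a complete normed space H over R[i] with an inner
   product ip such that `|x| ^+ 2 = ip x x; this last equation is a hypothesis
   of the theorem, and is not needed by the definitions below.  The inner
   product is linear in its first argument.  Operators are plain functions
   H -> H, so that equality of operators is Leibniz equality. *)
Section HilbertSpace.
Context {R : realType} {H : completeNormedModType R[i]}.

Definition bounded_operator (A : H -> H) : Prop :=
  linear A /\ exists M : R[i], forall x, `|A x| <= M * `|x|.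

Variable ip : {dot H for Num.conj}.

(* The order of R[i] makes 0 <= z imply that z is real. *)
Definition positive_operator (A : H -> H) : Prop :=
  bounded_operator A /\ forall x, 0 <= ip (A x) x.

(* The adjoint of a bounded operator exists and is unique; the default value 0
   is only reached by functions that have no adjoint. *)
Definition adjoint (A : H -> H) : H -> H :=
  xget (fun=> 0) [set B | forall x y, ip (A x) y = ip x (B y)].

(* The positive square root of a positive operator, which exists and is unique;
   the default value 0 is only reached outside of positive operators. *)
Definition operator_sqrt (A : H -> H) : H -> H :=
  xget (fun=> 0) [set S | positive_operator S /\ S \o S = A].

Definition absolute_value (A : H -> H) : H -> H :=
  operator_sqrt (adjoint A \o A).

Definition orthonormal_basis (B : set H) : Prop :=
  [/\ forall e, B e -> ip e e = 1,
      forall e f, B e -> B f -> e <> f -> ip e f = 0 &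
      forall x, (forall e, B e -> ip x e = 0) -> x = 0].

Definition hilbert_basis : set H := xget set0 orthonormal_basis.

(* The trace of a positive operator, as an element of [0, +oo].  It does not
   depend on the orthonormal basis.  It is meaningful on positive operators
   only, \esum being the supremum of the finite partial sums. *)
Definition trace (A : H -> H) : \bar R :=
  \esum_(e in hilbert_basis) (complex.Re (ip (A e) e))%:E.

Definition trace_class : set (H -> H) :=
  [set A | bounded_operator A /\ (trace (absolute_value A) < +oo)%E].

Definition positive_trace_class : set (H -> H) :=
  [set A | trace_class A /\ positive_operator A].

Definition fidelity (A B : H -> H) : R :=
  fine (trace (operator_sqrt (operator_sqrt A \o B \o operator_sqrt A))).

Definition bures_distance (A B : H -> H) : R :=
  Num.sqrt (fine (trace A) + fine (trace B) - 2 * fidelity A B).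

Definition unitary (U : H -> H) : Prop :=
  [/\ bounded_operator U, adjoint U \o U = id & U \o adjoint U = id].

Definition antiunitary (U : H -> H) : Prop :=
  [/\ linear_for (Num.conj \; *:%R) U, bijective U &
      forall x y, ip (U x) (U y) = Num.conj (ip x y)].

End HilbertSpace.

(* For an antiunitary U the adjoint is the inverse of U; the function adjoint
   above applies to linear operators only. *)
Definition antiunitary_adjoint {R : realType} {H : completeNormedModType R[i]}
    (U : H -> H) : H -> H :=
  'pinv_(fun=> 0) [set: H] U.

(* Main.v *)
Require Import Defs.
From mathcomp Require Import all_boot all_order all_algebra.
From mathcomp Require Import complex.
From mathcomp Require Import all_classical all_reals all_analysis.
From mathcomp Require Import ring lra.

(** The fidelity of a positive trace class operator [A] with the rank one
    operator of a vector [x] is the square root of [<Ax,x>].  The distances of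
    [A] to the rank one operators therefore determine [A], and the theorem
    reduces to showing that an isometry [phi] permutes the rank one operators:
    it then acts on vectors by some [T] with [|<Tx,Ty>| = |<x,y>|], Wigner's
    theorem makes [T] unitary or antiunitary up to phases, and comparing the
    distances of [A] and [phi A] to rank one operators gives
    [phi A = U A U^-1] ([isometry_implemented]).

    The first step is [phi 0 = 0].  The origin is the only point of the cone
    that is not a midpoint of two distinct points ([zero_not_midpoint],
    [nonzero_midpoint]), and midpoints are defined by the metric.  As
    [d(A,0)^2 = tr A], the map [phi] preserves the trace, and then also the
    quantity [overlap], which equals twice the fidelity except where the square
    root in the metric is cut off.

    The second step is a description of the rank one operators by overlaps
    ([is_ray]).  Call [B] dominated by [A] if [overlap B C <= overlap A C]
    whenever [overlap A C] is nonzero.  Testing with rank one [C] shows that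
    this implies [B <= A] ([dominated_le]).  Conversely the rank one operator
    of [y] is dominated by [A] if [y] is the image under the square root of [A]
    of a vector of the unit ball ([range_dominated]): if [S] is the square root
    of [sqrt A C sqrt A] and has finite trace [t], then [S^2 <= t^2], which
    bounds [<Cy,y>].  It follows that [A] has rank one exactly if it is nonzero
    and the operators that it dominates are determined by their traces
    ([ray_is_ray], [is_rayP]).

    Wigner's theorem ([wigner]) is proved by fixing a unit vector [e] and
    normalising the phase of [T (e + u)], for [u] orthogonal to [e], so that
    [T (e + u) = T e + V u].  Then [|1 + <Vu,Vv>| = |1 + <u,v>|] and
    [|<Vu,Vv>| = |<u,v>|], so [V] preserves real parts of inner products and is
    real linear; it is complex linear or conjugate linear because an additive
    group is not the union of two proper subgroups.

    Underneath lie the existence and uniqueness of positive square roots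
    ([sqrt_exists], [positive_sqrt_unique]), which give a meaning to all the
    definitions, and the density of finite expansions in an orthonormal basis
    ([proj_dense]), which evaluates the trace of a rank one operator and bounds
    a positive operator by its trace ([qform_le_tr]). *)

Set Implicit Arguments.
Unset Strict Implicit.
Unset Printing Implicit Defensive.

Import Order.TTheory GRing.Theory Num.Theory.
Import numFieldNormedType.Exports.

Local Open Scope classical_set_scope.
Local Open Scope ring_scope.
Local Open Scope complex_scope.

Local Notation Re := complex.Re.
Local Notation Im := complex.Im.
Local Notation normc := Normc.normc.

(** * Complex numbers and linear maps *)

Section ComplexNumbers.
Context {R : realType}.
Implicit Types (z w : R[i]) (a : R).

Lemma complex_ext z w : Re z = Re w -> Im z = Im w -> z = w.
Proof. by case: z => a b; case: w => c d /= -> ->. Qed.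

Lemma cReD z w : Re (z + w) = Re z + Re w. Proof. by case: z w => ? ? []. Qed.
Lemma cImD z w : Im (z + w) = Im z + Im w. Proof. by case: z w => ? ? []. Qed.
Lemma cReN z : Re (- z) = - Re z. Proof. by case: z. Qed.
Lemma cImN z : Im (- z) = - Im z. Proof. by case: z. Qed.
Lemma cReM z w : Re (z * w) = Re z * Re w - Im z * Im w.
Proof. by case: z w => ? ? []. Qed.
Lemma cImM z w : Im (z * w) = Re z * Im w + Im z * Re w.
Proof. by case: z w => ? ? []. Qed.
Lemma cReJ z : Re (z^*%R) = Re z. Proof. by case: z. Qed.
Lemma cImJ z : Im (z^*%R) = - Im z. Proof. by case: z. Qed.

Lemma conjcR a : (a%:C)^*%R = a%:C :> R[i].
Proof. exact: conjc_real. Qed.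

Lemma conjcM z w : (z * w)^*%R = z^*%R * w^*%R.
Proof. exact: rmorphM. Qed.

Definition ReIm := (cReD, cImD, cReN, cImN, cReM, cImM, cReJ, cImJ).

Lemma normcE z : `|z| = (normc z)%:C. Proof. by []. Qed.

Lemma normc_sqr z : normc z ^+ 2 = Re z ^+ 2 + Im z ^+ 2.
Proof. by case: z => a b /=; rewrite sqr_sqrtr // addr_ge0 ?sqr_ge0. Qed.

Lemma normc_ge0 z : 0 <= normc z.
Proof. by rewrite -ler0c -normcE. Qed.

Lemma normc_real a : normc a%:C = `|a|.
Proof. by rewrite /= expr0n addr0 sqrtr_sqr. Qed.

Lemma normc_eq0 z : (normc z == 0) = (z == 0).
Proof.
apply/eqP/eqP => [|->]; first exact: Normc.eq0_normc.
exact: Normc.normc0.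
Qed.

Lemma normc_conj z : normc z^*%R = normc z.
Proof. by case: z => a b /=; rewrite sqrrN. Qed.

Lemma normcN z : normc (- z) = normc z.
Proof. by case: z => a b /=; rewrite !sqrrN. Qed.

Lemma mulcJ z : z * z^*%R = (normc z ^+ 2)%:C.
Proof. by apply: complex_ext; rewrite ?ReIm normc_sqr /=; ring. Qed.

Lemma Re_le_normc z : Re z <= normc z.
Proof.
apply: (le_trans (ler_norm _)).
by rewrite -sqrtr_sqr -(ger0_norm (normc_ge0 z)) -sqrtr_sqr ler_wsqrtr //
  normc_sqr lerDl sqr_ge0.
Qed.

Lemma phase_exists z : exists2 u : R[i], normc u = 1 & u * z = (normc z)%:C.
Proof.
have [->|z0] := eqVneq z 0.
  by exists 1; rewrite ?Normc.normc1 // mulr0 Normc.normc0.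
have nz : normc z != 0 by rewrite normc_eq0.
exists (z^*%R / (normc z)%:C).
  by rewrite Normc.normcM Normc.normcV normc_real normc_conj
    ger0_norm ?normc_ge0 // divff.
rewrite mulrAC [_ * z]mulrC mulcJ -fmorphV -rmorphM /=; congr (_%:C).
by rewrite expr2 mulfK.
Qed.

Lemma complex_ge0P z : 0 <= z <-> Im z = 0 /\ 0 <= Re z.
Proof.
rewrite lecE /=; split => [/andP[/eqP -> ->]//|[-> ->]].
by rewrite eqxx.
Qed.

End ComplexNumbers.

Section LinearMaps.
Context {K : nzRingType} {V W : lmodType K} {A : V -> W}.
Hypothesis A_lin : linear A.

Lemma lin0 : A 0 = 0.
Proof. by have := A_lin (-1) 0 0; rewrite scaler0 addr0 scaleN1r addNr. Qed.
Lemma linD x y : A (x + y) = A x + A y.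
Proof. by have := A_lin 1 x y; rewrite !scale1r. Qed.
Lemma linZ c x : A (c *: x) = c *: A x.
Proof. by have := A_lin c x 0; rewrite !addr0 lin0 addr0. Qed.
Lemma linN x : A (- x) = - A x.
Proof. by rewrite -scaleN1r linZ scaleN1r. Qed.
Lemma linB x y : A (x - y) = A x - A y.
Proof. by rewrite linD linN. Qed.

End LinearMaps.

Lemma linear_comp (K : nzRingType) (V : lmodType K) (A B : V -> V) :
  linear A -> linear B -> linear (A \o B).
Proof. by move=> lA lB c x y /=; rewrite lB lA. Qed.

(** * Inner products and positive forms *)

Section InnerProduct.
Context {R : realType} {H : completeNormedModType R[i]}.
Variable ip : {dot H for Num.conj}.
Implicit Types (x y z : H) (c : R[i]) (a : R) (A : H -> H).

Lemma ipDl x y z : ip (x + y) z = ip x z + ip y z. Proof. exact: linearDl. Qed.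
Lemma ipDr x y z : ip z (x + y) = ip z x + ip z y. Proof. exact: linearDr. Qed.
Lemma ipZl c x y : ip (c *: x) y = c * ip x y.
Proof. by rewrite linearZl_LR. Qed.
Lemma ipZr c x y : ip x (c *: y) = c^*%R * ip x y.
Proof. by rewrite linearZr_LR. Qed.
Lemma ipNl x y : ip (- x) y = - ip x y. Proof. exact: linearNl. Qed.
Lemma ipNr x y : ip x (- y) = - ip x y. Proof. exact: linearNr. Qed.
Lemma ip0l y : ip 0 y = 0. Proof. exact: linear0l. Qed.
Lemma ip0r y : ip y 0 = 0. Proof. exact: linear0r. Qed.
Lemma ipC x y : ip y x = (ip x y)^*%R.
Proof. by rewrite hermC expr0 mul1r. Qed.

Definition ipE := (ipDl, ipDr, ipNl, ipNr, ipZl, ipZr).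

(** The squared norm, and below the norm itself, as real numbers: the norm of
    [H] takes its values in [R[i]], whose order is not total. *)
Definition sq x : R := Re (ip x x).

Lemma ipxx x : ip x x = (sq x)%:C.
Proof.
have /complex_ge0P[i0 _] : 0 <= ip x x by exact: dnorm_ge0.
exact: complex_ext.
Qed.

Lemma sq_ge0 x : 0 <= sq x.
Proof. by rewrite -ler0c -ipxx; exact: dnorm_ge0. Qed.

Lemma sq0P x : sq x = 0 <-> x = 0.
Proof.
split=> [x0|->]; last by rewrite /sq ip0l.
by apply/eqP; rewrite -(dnorm_eq0 ip) ipxx x0.
Qed.

Lemma sq_gt0 x : x != 0 -> 0 < sq x.
Proof.
move=> x0; rewrite lt_def sq_ge0 andbT.
by apply: contra x0 => /eqP/sq0P ->.
Qed.

Lemma sqZ c x : sq (c *: x) = normc c ^+ 2 * sq x.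
Proof. by rewrite /sq ipZl ipZr mulrA mulcJ ipxx -rmorphM. Qed.

Lemma sqN x : sq (- x) = sq x.
Proof. by rewrite /sq ipNl ipNr opprK. Qed.

Lemma sqD x y : sq (x + y) = sq x + sq y + 2 * Re (ip x y).
Proof. by rewrite /sq !ipE (ipC x y) !ReIm; ring. Qed.

Lemma sqB x y : sq (x - y) = sq x + sq y - 2 * Re (ip x y).
Proof. by rewrite sqD sqN ipNr cReN; ring. Qed.

Lemma ip_left_inj x y : (forall z, ip x z = ip y z) -> x = y.
Proof.
move=> e; apply/eqP; rewrite -subr_eq0; apply/eqP/sq0P.
by rewrite /sq ipDl ipNl e subrr.
Qed.

Definition nm x : R := Num.sqrt (sq x).

Lemma nm_ge0 x : 0 <= nm x. Proof. exact: sqrtr_ge0. Qed.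
Lemma nm_sqr x : nm x ^+ 2 = sq x. Proof. exact/sqr_sqrtr/sq_ge0. Qed.
Lemma nm0P x : nm x = 0 <-> x = 0.
Proof.
split=> [x0|->]; first by apply/sq0P; rewrite -nm_sqr x0 expr0n.
by rewrite /nm /sq ip0l /= sqrtr0.
Qed.
Lemma nm_gt0 x : x != 0 -> 0 < nm x.
Proof. by move=> x0; rewrite sqrtr_gt0 sq_gt0. Qed.
Lemma nmZ c x : nm (c *: x) = normc c * nm x.
Proof. by rewrite /nm sqZ sqrtrM ?sqr_ge0 // sqrtr_sqr ger0_norm ?normc_ge0. Qed.
Lemma nmN x : nm (- x) = nm x. Proof. by rewrite /nm sqN. Qed.

Definition qform A x : R := Re (ip (A x) x).

Lemma positive_lin A : positive_operator ip A -> linear A.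
Proof. by case=> -[]. Qed.

Section Positive.
Variable A : H -> H.
Hypothesis A_lin : linear A.
Hypothesis A_pos : forall x, 0 <= ip (A x) x.

Lemma qform_ge0 x : 0 <= qform A x.
Proof. by have /complex_ge0P[] := A_pos x. Qed.

Lemma ip_qform x : ip (A x) x = (qform A x)%:C.
Proof. by have /complex_ge0P[i0 _] := A_pos x; exact: complex_ext. Qed.

(** A complex quadratic form with real values is hermitian: compare the
    imaginary parts of its values at [x + y] and [x + iy]. *)
Lemma positive_selfadjoint x y : ip (A x) y = ip x (A y).
Proof.
rewrite (ipC (A y) x).
have im0 z : Im (ip (A z) z) = 0 by have /complex_ge0P[] := A_pos z.
have := im0 (x + y); have := im0 (x + 'i *: y).
rewrite !(linD A_lin, linZ A_lin) !ipE !ReIm /= !im0.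
by move=> e1 e2; apply: complex_ext; rewrite ?ReIm; lra.
Qed.

(** With [b = <Ax,y>], the form is nonnegative at [x - t b y] for every real
    [t].  If [<Ay,y>] is positive then its inverse is the optimal [t];
    otherwise the expansion is affine in [t] and forces [b = 0]. *)
Lemma positive_CS x y : normc (ip (A x) y) ^+ 2 <= qform A x * qform A y.
Proof.
set b := ip (A x) y; have := normc_sqr b.
move: (normc b ^+ 2) => n nb2.
have byx : ip (A y) x = b^*%R by rewrite /b positive_selfadjoint ipC.
have key t : 0 <= qform A x - 2 * t * n + t ^+ 2 * n * qform A y.
  have := qform_ge0 (x - (t%:C * b) *: y).
  rewrite /qform !(linB A_lin, linZ A_lin) !ipE -/b byx !ip_qform !ReIm /=.
  by rewrite nb2; congr (0 <= _); ring.
have := qform_ge0 y; rewrite le_eqVlt => /orP[/eqP y0|y0].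
  rewrite -y0 mulr0; move: key; rewrite -y0 => key.
  have [n0|//] := ltP 0 n.
  have := key ((qform A x + 1) / (2 * n)).
  have -> : 2 * ((qform A x + 1) / (2 * n)) * n = qform A x + 1.
    by field; rewrite gt_eqF.
  lra.
have := key (qform A y)^-1.
have -> : qform A x - 2 / qform A y * n + (qform A y)^-1 ^+ 2 * n * qform A y
   = (qform A x * qform A y - n) / qform A y.
  by field; rewrite gt_eqF.
by rewrite pmulr_lge0 ?invr_gt0 // subr_ge0.
Qed.

Lemma qform_eq0 x : qform A x = 0 -> A x = 0.
Proof.
move=> q0; apply/sq0P.
have := positive_CS x (A x); rewrite q0 mul0r ipxx normc_real real_normK ?num_real //.
by move=> h; apply/eqP; rewrite -sqrf_eq0 eq_le h sqr_ge0.
Qed.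

End Positive.

Lemma id_pos x : 0 <= ip (idfun x) x.
Proof. exact: dnorm_ge0. Qed.

Lemma cauchy_schwarz x y : normc (ip x y) <= nm x * nm y.
Proof.
rewrite -(ler_pXn2r (_ : (0 < 2)%N)) ?nnegrE ?mulr_ge0 ?nm_ge0 ?normc_ge0 //.
rewrite exprMn !nm_sqr; exact: (@positive_CS idfun _ id_pos).
Qed.

Lemma nm_triangle x y : nm (x + y) <= nm x + nm y.
Proof.
rewrite -(ler_pXn2r (_ : (0 < 2)%N)) ?nnegrE ?addr_ge0 ?nm_ge0 //.
rewrite nm_sqr sqD sqrrD !nm_sqr.
have := Re_le_normc (ip x y); have := cauchy_schwarz x y.
move: (nm x * nm y) => m; rewrite -mulr_natl; lra.
Qed.

Lemma nm_triangleB x y : nm (x - y) <= nm x + nm y.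
Proof. by rewrite -(nmN y) nm_triangle. Qed.

Lemma nm_distC x y : nm (x - y) = nm (y - x).
Proof. by rewrite -nmN opprB. Qed.

End InnerProduct.

Section Norm.
Context {R : realType} {H : completeNormedModType R[i]}.
Variable ip : {dot H for Num.conj}.
Hypothesis ip_norm : forall x : H, `|x| ^+ 2 = ip x x.
Implicit Types (x y : H).

Lemma normE x : `|x| = (nm ip x)%:C.
Proof.
apply/eqP; rewrite -(@eqrXn2 _ 2) ?normr_ge0 // ?ler0c ?nm_ge0 //.
by rewrite ip_norm ipxx -nm_sqr rmorphXn.
Qed.

Lemma bounded_operatorP (A : H -> H) : bounded_operator A <->
  linear A /\ exists2 M : R, 0 <= M & forall x, nm ip (A x) <= M * nm ip x.
Proof.
split=> -[lA]; last first.
  move=> [M M0 hM]; split=> //; exists M%:C => x.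
  by rewrite !normE -rmorphM lecR.
move=> [M hM]; split=> //; exists (normc M); rewrite ?normc_ge0 // => x.
have eM : (normc M * nm ip x)%:C = `|M| * `|x|.
  by rewrite normE normcE -rmorphM.
rewrite -lecR eM -normE.
have /ger0_norm <- : 0 <= `|A x| by [].
have h := hM x; have h0 := le_trans (normr_ge0 _) h.
by rewrite normr_id; move: h; rewrite -(ger0_norm h0) normrM normr_id.
Qed.

End Norm.

(** * Square roots of positive operators *)

Section SquareRoot.
Context {R : realType} {H : completeNormedModType R[i]}.
Variable ip : {dot H for Num.conj}.
Hypothesis ip_norm : forall x : H, `|x| ^+ 2 = ip x x.
Implicit Types (x y z : H) (A B C S T : H -> H).
Local Notation nm := (nm ip).
Local Notation sq := (sq ip).

(** Completeness of [H] in terms of the real valued norm. *)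
Lemma hilbert_complete (u : nat -> H) :
  (forall e : R, 0 < e ->
     exists N, forall m n, (N <= m)%N -> (N <= n)%N -> nm (u m - u n) < e) ->
  exists l, forall e : R, 0 < e ->
     exists N, forall n, (N <= n)%N -> nm (u n - l) < e.
Proof.
move=> u_cauchy.
have : cauchy (u @ \oo).
  apply: cauchy_exP => e e0; have /complex_ge0P[ie re] := ltW e0.
  have e_real : e = (Re e)%:C by exact: complex_ext.
  have re0 : 0 < Re e by move: e0; rewrite {1}e_real (ltcR 0).
  have [N uN] := u_cauchy _ re0; exists (u N).
  exists N => // n /= Nn; rewrite -ball_normE /= (normE ip_norm) e_real ltcR.
  exact: uN.
move=> /cauchy_cvg/cvg_ex[l /cvgrPdist_lt ul]; exists l => e e0.
have [N _ hN] := ul e%:C (etrans (ltcR 0 e) e0).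
exists N => n Nn; have := hN n Nn.
by rewrite /= (normE ip_norm) ltcR nm_distC.
Qed.

Section Iteration.
Variable B : H -> H.
Hypothesis B_lin : linear B.
Hypothesis B_sa : forall x y, ip (B x) y = ip x (B y).
Hypothesis B_contr : forall x, nm (B x) <= nm x.

(** For [B = 1 - A] with [0 <= A <= 1], a fixed point [Y] of the map
    [Y |-> (B + Y^2) / 2] satisfies [(1 - Y)^2 = A].  The iterates of this map
    from 0 converge: the difference of consecutive iterates is bounded in norm
    by the corresponding difference for the number 1 in place of [B], and these
    numbers increase and stay below 1. *)
Fixpoint sqrt_iter n x : H :=
  if n is m.+1 then (2^-1)%:C *: (B x + sqrt_iter m (sqrt_iter m x)) else 0.

Fixpoint maj n : R := if n is m.+1 then 2^-1 * (1 + maj m ^+ 2) else 0.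

Local Notation Y := sqrt_iter.

Lemma maj_itv n : 0 <= maj n <= 1.
Proof. by elim: n => [|n IH] /=; nra. Qed.

Lemma maj_step n : maj n <= maj n.+1.
Proof. have := maj_itv n => /=; nra. Qed.

Lemma maj_homo m n : (m <= n)%N -> maj m <= maj n.
Proof.
move=> /subnKC <-; elim: (n - m)%N => [|k IH]; first by rewrite addn0.
by rewrite addnS (le_trans IH) // maj_step.
Qed.

Let L := sup (range maj).

Lemma maj_has_sup : has_sup (range maj).
Proof.
by split; [exists 0, 0%N|exists 1 => _ [n _ <-]; case/andP: (maj_itv n)].
Qed.

(* The error bound of the n-th iterate. *)
Let d n := L - maj n.

Lemma d_ge0 n : 0 <= d n.
Proof. by rewrite subr_ge0; apply: ub_le_sup; [case: maj_has_sup|exists n]. Qed.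

Lemma d_step n : d n.+1 <= d n.
Proof. by rewrite lerD2l lerN2 maj_step. Qed.

Lemma d_small (e : R) : 0 < e -> exists n, d n < e.
Proof.
move=> e0; have [_ [n _ <-] hn] := sup_adherent e0 maj_has_sup.
by exists n; rewrite /d ltrBlDl -ltrBlDr.
Qed.

Lemma d_squeeze (a K : R) : (forall n, a <= K * d n) -> a <= 0.
Proof.
move=> h; rewrite leNgt; apply/negP => a0.
have K0 : 0 < K.
  rewrite ltNge; apply/negP => K0.
  have := h 0%N; have := d_ge0 0%N; nra.
have [n] := d_small (divr_gt0 a0 K0).
by rewrite ltr_pdivlMr // mulrC => /(le_lt_trans (h n)); rewrite ltxx.
Qed.

Lemma d_nm0 x K : (forall n, nm x <= K * d n) -> x = 0.
Proof. by move=> /d_squeeze h; apply/(nm0P ip)/eqP; rewrite eq_le h nm_ge0. Qed.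

Lemma half_nm x : nm ((2^-1)%:C *: x) = 2^-1 * nm x.
Proof. by rewrite nmZ normc_real ger0_norm. Qed.

Lemma iter_lin n : linear (Y n).
Proof.
elim: n => [|n IH] c x y /=; first by rewrite scaler0 addr0.
by rewrite B_lin !IH [RHS]addrC scalerA [c * _]mulrC -scalerA -scalerDr;
  congr (_ *: _); rewrite scalerDr addrACA addrC.
Qed.

Lemma iter_sa n x y : ip (Y n x) y = ip x (Y n y).
Proof.
elim: n x y => [|n IH] x y /=; first by rewrite ip0l ip0r.
by rewrite !ipE conjcR B_sa !IH.
Qed.

Lemma iter_bound n x : nm (Y n x) <= maj n * nm x.
Proof.
elim: n x => [|n IH] x /=.
  by rewrite mul0r (_ : nm 0 = 0) //; apply/(nm0P ip).
rewrite half_nm -mulrA ler_pM2l ?invr_gt0 // mulrDl mul1r.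
apply: (le_trans (nm_triangle _ _ _)); rewrite lerD //.
apply: (le_trans (IH _)); rewrite expr2 -mulrA ler_wpM2l //.
by case/andP: (maj_itv n).
Qed.

Lemma iter_step n x : nm (Y n.+1 x - Y n x) <= (maj n.+1 - maj n) * nm x.
Proof.
elim: n x => [|n IH] x.
  rewrite /= subr0 addr0 half_nm expr0n addr0 mulr1 subr0.
  by rewrite ler_pM2l ?invr_gt0.
(* [P^2 - Q^2 = P (P - Q) + (P - Q) Q] for consecutive iterates [P], [Q]. *)
have -> : Y n.+2 x - Y n.+1 x = (2^-1)%:C *:
    (Y n.+1 (Y n.+1 x - Y n x) + (Y n.+1 (Y n x) - Y n (Y n x))).
  rewrite (linB (iter_lin n.+1)) addrA subrK.
  transitivity ((2^-1)%:C *: (B x + Y n.+1 (Y n.+1 x))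
    - (2^-1)%:C *: (B x + Y n (Y n x))); first by [].
  by rewrite -scalerBr opprD addrACA subrr add0r.
have -> : (maj n.+2 - maj n.+1) * nm x = 2^-1 * (maj n.+1 *
     ((maj n.+1 - maj n) * nm x) + (maj n.+1 - maj n) * (maj n * nm x)).
  have -> : maj n.+2 = 2^-1 * (1 + maj n.+1 ^+ 2) by [].
  have {2}-> : maj n.+1 = 2^-1 * (1 + maj n ^+ 2) by [].
  by ring.
rewrite half_nm ler_pM2l ?invr_gt0 //.
have d0 : 0 <= maj n.+1 - maj n by rewrite subr_ge0 maj_step.
apply: (le_trans (nm_triangle _ _ _)); apply: lerD.
  apply: (le_trans (iter_bound _ _)); apply: ler_wpM2l => //.
  by case/andP: (maj_itv n.+1).
apply: (le_trans (IH _)); apply: ler_wpM2l => //; exact: iter_bound.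
Qed.

Lemma iter_cauchy m n x : (m <= n)%N ->
  nm (Y n x - Y m x) <= (maj n - maj m) * nm x.
Proof.
move=> /subnKC <-; elim: (n - m)%N => [|k IH].
  by rewrite addn0 !subrr mul0r (_ : nm 0 = 0) //; apply/(nm0P ip).
rewrite addnS.
rewrite -(subrKA (Y (m + k) x)) -(subrKA (maj (m + k))) mulrDl.
apply: (le_trans (nm_triangle _ _ _)).
by apply: lerD => //; exact: iter_step.
Qed.

Lemma iter_cvg : exists Yl : H -> H,
  forall x n, nm (Yl x - Y n x) <= d n * nm x.
Proof.
suff /choice[Yl hYl] : forall x, exists l, forall n, nm (l - Y n x) <= d n * nm x.
  by exists Yl.
move=> x.
have [e e0|l hl] := @hilbert_complete (Y ^~ x).
  have k0 : 0 < nm x + 1 by have := nm_ge0 ip x; lra.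
  have [N hN] := d_small (divr_gt0 e0 k0).
  have main m n : (N <= m)%N -> (m <= n)%N -> nm (Y n x - Y m x) < e.
    move=> Nm mn; apply: (le_lt_trans (iter_cauchy x mn)).
    have dm : maj n - maj m <= d N.
      have := d_ge0 n; rewrite /d; have := maj_homo Nm; lra.
    move: hN; rewrite ltr_pdivlMr // => hN.
    have := nm_ge0 ip x; have := d_ge0 N; nra.
  exists N => m n Nm Nn; case: (leqP m n) => [mn|/ltnW nm'].
    by rewrite nm_distC; exact: main.
  exact: main.
exists l => n; apply/ler_addgt0Pr => e e0.
have [N hN] := hl _ e0.
pose m := maxn N n.
rewrite -[l](subrK (Y m x)) -addrA addrC.
apply: (le_trans (nm_triangle _ _ _)); apply: lerD.
  apply: (le_trans (iter_cauchy x (leq_maxr _ _))); apply: ler_wpM2r.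
    exact: nm_ge0.
  by rewrite lerD2r -subr_ge0 d_ge0.
by rewrite nm_distC ltW // hN // leq_maxl.
Qed.

Lemma iter_comm C n x : linear C -> (forall x, C (B x) = B (C x)) ->
  C (Y n x) = Y n (C x).
Proof.
move=> lC CB; elim: n x => [|n IH] x /=; first exact: lin0.
by rewrite (linZ lC) (linD lC) CB !IH.
Qed.

(** Every property below passes from the iterates to the limit in the same
    way: the norm of the defect is at most a constant times [d n]. *)
Lemma sqrt_iter_limit : exists Yl : H -> H,
  [/\ linear Yl, forall x y, ip (Yl x) y = ip x (Yl y),
      forall x, nm (Yl x) <= nm x,
      forall x, Yl x = (2^-1)%:C *: (B x + Yl (Yl x)) &
      forall C, bounded_operator C -> (forall x, C (B x) = B (C x)) ->
        forall x, C (Yl x) = Yl (C x)].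
Proof.
have [Yl Yl_cvg] := iter_cvg; exists Yl.
have d1 n : maj n <= 1 by case/andP: (maj_itv n).
have iter_contr n x : nm (Y n x) <= nm x.
  by apply: (le_trans (iter_bound n x)); rewrite ler_piMl ?nm_ge0.
have Yl_contr x : nm (Yl x) <= nm x.
  rewrite -subr_le0; apply: (@d_squeeze _ (nm x)) => n.
  rewrite lerBlDl -{1}[Yl x](subrK (Y n x)) addrC mulrC.
  by apply: (le_trans (nm_triangle _ _ _)); apply: lerD.
split=> //.
- move=> c x y; apply/eqP; rewrite -subr_eq0; apply/eqP.
  apply: (@d_nm0 _ (nm (c *: x + y) + (normc c * nm x + nm y))) => n.
  have -> : Yl (c *: x + y) - (c *: Yl x + Yl y) =
    (Yl (c *: x + y) - Y n (c *: x + y)) - (c *: (Yl x - Y n x) + (Yl y - Y n y)).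
    by rewrite iter_lin scalerBr addrACA -opprD opprB addrA subrK.
  apply: (le_trans (nm_triangleB _ _ _)); rewrite mulrDl mulrC.
  apply: lerD => //; apply: (le_trans (nm_triangle _ _ _)).
  rewrite mulrDl nmZ; apply: lerD; last by rewrite mulrC.
  by rewrite -mulrA ler_wpM2l ?normc_ge0 // mulrC.
- move=> x y; apply/eqP; rewrite -subr_eq0 -normc_eq0 eq_le normc_ge0 andbT.
  apply: (@d_squeeze _ (nm x * nm y + nm x * nm y)) => n.
  have -> : ip (Yl x) y - ip x (Yl y) =
     ip (Yl x - Y n x) y - ip x (Yl y - Y n y).
    by rewrite !ipE iter_sa opprD addrACA subrr addr0.
  apply: (le_trans (@le_normcD _ _ _)); rewrite normcN mulrDl.
  apply: lerD; apply: (le_trans (cauchy_schwarz _ _ _)).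
    by rewrite mulrAC ler_wpM2r ?nm_ge0 // mulrC.
  by rewrite -mulrA ler_wpM2l ?nm_ge0 // mulrC.
- move=> x; apply/eqP; rewrite -subr_eq0; apply/eqP.
  apply: (@d_nm0 _ (nm x + 2^-1 * (nm x + nm (Yl x)))) => n.
  have -> : Yl x - (2^-1)%:C *: (B x + Yl (Yl x)) = (Yl x - Y n.+1 x)
    - (2^-1)%:C *: (Y n (Yl x - Y n x) + (Yl (Yl x) - Y n (Yl x))).
    rewrite (linB (iter_lin n)) [_ + (Yl (Yl x) - _)]addrC subrKA.
    rewrite -[Y n.+1 x]/((2^-1)%:C *: (B x + Y n (Y n x))) -addrA -opprD.
    by rewrite -scalerDr -addrA [Y n (Y n x) + _]addrC subrK.
  apply: (le_trans (nm_triangleB _ _ _)); rewrite mulrDl; apply: lerD.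
    apply: (le_trans (Yl_cvg _ _)); rewrite mulrC.
    by rewrite ler_wpM2l ?nm_ge0 ?d_step.
  rewrite half_nm -mulrA ler_pM2l ?invr_gt0 //.
  apply: (le_trans (nm_triangle _ _ _)); rewrite mulrDl; apply: lerD.
    by apply: (le_trans (iter_contr _ _)); rewrite mulrC.
  by rewrite mulrC.
move=> C /(bounded_operatorP ip_norm)[lC [M M0 C_bd]] CB x.
apply/eqP; rewrite -subr_eq0; apply/eqP.
apply: (@d_nm0 _ (M * nm x + nm (C x))) => n.
have -> : C (Yl x) - Yl (C x) = C (Yl x - Y n x) - (Yl (C x) - Y n (C x)).
  by rewrite (linB lC) iter_comm // opprB addrA subrK.
apply: (le_trans (nm_triangleB _ _ _)); rewrite mulrDl; apply: lerD.
  by apply: (le_trans (C_bd _)); rewrite -mulrA ler_wpM2l // mulrC.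
by rewrite mulrC.
Qed.

End Iteration.

Lemma positive_sa A : positive_operator ip A ->
  forall x y, ip (A x) y = ip x (A y).
Proof. by move=> [[lA _] pA]; apply: positive_selfadjoint. Qed.

Lemma positive_bound A : positive_operator ip A ->
  exists2 M : R, 0 < M & forall x, qform ip A x <= M * sq x.
Proof.
move=> [/(bounded_operatorP ip_norm)[lA [M M0 A_bd]] _].
exists (M + 1) => [|x]; first by lra.
apply: (le_trans (Re_le_normc _)); apply: (le_trans (cauchy_schwarz _ _ _)).
have := A_bd x; have := nm_ge0 ip x; rewrite -nm_sqr; nra.
Qed.

Lemma positiveZ (a : R) A : 0 <= a -> positive_operator ip A ->
  positive_operator ip (fun x => a%:C *: A x).
Proof.
move=> a0 [/(bounded_operatorP ip_norm)[lA [M M0 A_bd]] pA]; split.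
  apply/(bounded_operatorP ip_norm); split=> [c x y|].
    by rewrite lA scalerDr !scalerA mulrC.
  exists (a * M) => [|x]; first exact: mulr_ge0.
  by rewrite nmZ normc_real ger0_norm // -mulrA ler_wpM2l.
by move=> x; rewrite ipZl mulr_ge0 // ler0c.
Qed.

(** The square root of a positive operator below the identity, as the limit
    of the iteration for [1 - A]. *)
Lemma sqrt_exists_contr A : positive_operator ip A ->
  (forall x, qform ip A x <= sq x) ->
  exists S, [/\ positive_operator ip S, forall x, S (S x) = A x &
    forall C, bounded_operator C -> (forall x, C (A x) = A (C x)) ->
      forall x, C (S x) = S (C x)].
Proof.
move=> posA A1; have [[lA _] pA] := posA; have saA := positive_sa posA.
pose B x := x - A x.
have lB : linear B.
  by move=> c x y; rewrite /B lA scalerBr opprD addrACA.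
have saB x y : ip (B x) y = ip x (B y) by rewrite /B !ipE saA.
have pB x : 0 <= ip (B x) x.
  rewrite /B ipDl ipNl ipxx (ip_qform pA) -rmorphB ler0c subr_ge0; exact: A1.
have qB x : qform ip B x <= sq x.
  by rewrite /qform /B ipDl ipNl !ReIm -/(qform ip A x) gerBl (qform_ge0 pA).
have cB x : nm (B x) <= nm x.
  have := positive_CS lB pB x (B x); rewrite ipxx normc_real ger0_norm ?sq_ge0 //.
  move=> h; rewrite ler_wsqrtr //.
  have [->|h0] := eqVneq (sq (B x)) 0; first exact: sq_ge0.
  have B0 : 0 < sq (B x) by rewrite lt_def h0 sq_ge0.
  rewrite -(ler_pM2r B0) -expr2; apply: (le_trans h).
  by apply: ler_pM; rewrite ?qB ?(qform_ge0 pB).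
have [Y [lY saY Y_contr Y_fix Y_comm]] := sqrt_iter_limit lB saB cB.
exists (fun x => x - Y x).
have lS : linear (fun x => x - Y x).
  by move=> c x y; rewrite lY scalerBr opprD addrACA.
split.
- split.
    apply/(bounded_operatorP ip_norm); split=> //; exists 2 => // x.
    apply: (le_trans (nm_triangleB _ _ _)); have := Y_contr x; lra.
  move=> x; apply/complex_ge0P; split.
    have := saY x x; rewrite (ipC ip (Y x) x) => h.
    rewrite ipDl ipNl ipxx !ReIm /=.
    by have := congr1 (@complex.Im R) h; rewrite cImJ; lra.
  rewrite ipDl ipNl ipxx !ReIm /= subr_ge0.
  apply: (le_trans (Re_le_normc _)); apply: (le_trans (cauchy_schwarz _ _ _)).
  by rewrite -nm_sqr expr2 ler_wpM2r ?nm_ge0.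
- move=> x; have h := Y_fix x.
  have {h}h : Y x + Y x = x - A x + Y (Y x).
    rewrite -[x - A x]/(B x) {1 2}h -scalerDl -rmorphD /=.
    by rewrite (_ : 2^-1 + 2^-1 = 1 :> R) ?scale1r //; field.
  rewrite (linB lY) opprB addrACA -opprD h.
  by rewrite opprD addrACA subrr addr0 opprB addrC subrK.
move=> C bC CA x; have [lC _] := bC.
rewrite (linB lC) Y_comm // => {}x.
by rewrite /B (linB lC) CA.
Qed.

(** The commutation with everything that commutes with [A] is what makes the
    square root unique. *)
Theorem sqrt_exists A : positive_operator ip A ->
  exists S, [/\ positive_operator ip S, forall x, S (S x) = A x &
    forall C, bounded_operator C -> (forall x, C (A x) = A (C x)) ->
      forall x, C (S x) = S (C x)].
Proof.
move=> posA; have [M M0 A_bd] := positive_bound posA.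
have iM0 : 0 <= M^-1 by rewrite invr_ge0 ltW.
have [x|S [posS SS S_comm]] := sqrt_exists_contr (positiveZ iM0 posA).
  by rewrite /qform ipZl cReM /= mul0r subr0 ler_pdivrMl //; exact: A_bd.
exists (fun x => (Num.sqrt M)%:C *: S x); have lS := positive_lin posS.
split; first exact: positiveZ (sqrtr_ge0 _) posS.
  move=> x; rewrite (linZ lS) SS !scalerA -!rmorphM /= -expr2.
  by rewrite sqr_sqrtr ?ltW // divff ?gt_eqF // scale1r.
move=> C bC CA x; have [lC _] := bC.
by rewrite (linZ lC) S_comm // => {}x; rewrite (linZ lC) CA.
Qed.

Lemma bounded_comp A B : bounded_operator A -> bounded_operator B ->
  bounded_operator (A \o B).
Proof.
move=> /(bounded_operatorP ip_norm)[lA [M M0 A_bd]].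
move=> /(bounded_operatorP ip_norm)[lB [N N0 B_bd]].
apply/(bounded_operatorP ip_norm); split; first exact: linear_comp.
exists (M * N) => [|x /=]; first exact: mulr_ge0.
by apply: (le_trans (A_bd _)); rewrite -mulrA ler_wpM2l.
Qed.

Lemma positive_sqr S : positive_operator ip S -> positive_operator ip (S \o S).
Proof.
move=> posS; have [bS _] := posS; split; first exact: bounded_comp.
by move=> x /=; rewrite (positive_sa posS) dnorm_ge0.
Qed.

Lemma positive_conj S A : positive_operator ip S -> positive_operator ip A ->
  positive_operator ip (S \o A \o S).
Proof.
move=> posS [bA pA]; have [bS _] := posS; split.
  by do 2!apply: bounded_comp => //.
by move=> x /=; rewrite (positive_sa posS).
Qed.

(** A positive square root [T] of [A] commutes with [A], hence with the square
    root [S0] above, so [D = S0 - T] satisfies [(S0 + T) D = 0].  Both terms of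
    [<S0 Dx, Dx> + <T Dx, Dx> = 0] are nonnegative, whence [D (D x) = 0]. *)
Lemma positive_sqrt_unique S T : positive_operator ip S ->
  positive_operator ip T -> (forall x, S (S x) = T (T x)) -> S = T.
Proof.
have main A T' : positive_operator ip T' ->
    forall S0, positive_operator ip S0 -> (forall x, S0 (S0 x) = A x) ->
    (forall C, bounded_operator C -> (forall x, C (A x) = A (C x)) ->
      forall x, C (S0 x) = S0 (C x)) ->
    (forall x, T' (T' x) = A x) -> T' = S0.
  move=> posT S0 posS SS S_comm TT; apply/funext => x.
  have [[lT bT] pT] := posT; have [[lS bS] pS] := posS.
  pose D y := S0 y - T' y.
  have TS y : T' (S0 y) = S0 (T' y).
    by apply: S_comm => // z; rewrite -!TT.
  have sumD y : S0 (D y) + T' (D y) = 0.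
    by rewrite /D (linB lS) (linB lT) SS TT TS addrA subrK subrr.
  have DD y : D (D y) = 0.
    have : qform ip S0 (D y) + qform ip T' (D y) = 0.
      by rewrite /qform -cReD -ipDl sumD ip0l.
    have := qform_ge0 pS (D y); have := qform_ge0 pT (D y) => h1 h2 h3.
    by rewrite {1}/D (qform_eq0 lS pS) ?(qform_eq0 lT pT) ?subr0 //; lra.
  apply/esym/eqP; rewrite -subr_eq0; apply/eqP/(sq0P ip).
  rewrite /sq -/(D x) {1}/D ipDl ipNl (positive_sa posS) (positive_sa posT).
  by rewrite -ipNr -ipDr -/(D (D x)) DD ip0r.
move=> posS posT ST.
have [S0 [pos0 SS0 S0_comm]] := sqrt_exists (positive_sqr posS).
have -> : S = S0 by exact: (main _ _ posS _ pos0 SS0 S0_comm).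
by apply/esym; apply: (main _ _ posT _ pos0 SS0 S0_comm) => x; rewrite /= ST.
Qed.

Lemma operator_sqrt_eq A S : positive_operator ip S ->
  (forall x, S (S x) = A x) -> operator_sqrt ip A = S.
Proof.
move=> posS SS; rewrite /operator_sqrt.
have eSS : S \o S = A by apply/funext => x /=.
have /= := @xgetI _ (fun=> 0) [set S | positive_operator ip S /\ S \o S = A] S
  (conj posS eSS).
set T := xget _ _ => -[posT TT]; apply: positive_sqrt_unique => // x.
by rewrite SS -TT.
Qed.

Lemma operator_sqrtP A : positive_operator ip A ->
  positive_operator ip (operator_sqrt ip A) /\
  forall x, operator_sqrt ip A (operator_sqrt ip A x) = A x.
Proof.
move=> posA; have [S [posS SS _]] := sqrt_exists posA.
by rewrite (operator_sqrt_eq posS SS).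
Qed.

End SquareRoot.

(** * Orthonormal bases and Parseval's identity *)

Section OrthonormalBases.
Context {R : realType} {H : completeNormedModType R[i]}.
Variable ip : {dot H for Num.conj}.
Hypothesis ip_norm : forall x : H, `|x| ^+ 2 = ip x x.
Implicit Types (x y z e : H) (A : H -> H) (s t : seq H).
Local Notation nm := (nm ip).
Local Notation sq := (sq ip).
Local Notation qform := (qform ip).

Definition orthonormal_set (B : set H) :=
  (forall e, B e -> ip e e = 1) /\
  (forall e f, B e -> B f -> e <> f -> ip e f = 0).

Lemma ip_conj0 x y : ip x y = 0 -> ip y x = 0.
Proof. by move=> h; rewrite ipC h conjC0. Qed.

(** A maximal orthonormal set, given by Zorn's lemma, is total: a nonzero
    vector orthogonal to it could be normalised and added. *)
Lemma orthonormal_basis_exists : exists B, orthonormal_basis ip B.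
Proof.
have [F F_on F_tot|B [[B1 B0] B_max]] := @Zorn_bigcup _ orthonormal_set.
  split=> [e [X FX Xe]|e f [X FX Xe] [Y FY Yf]].
    by have [X1 _] := F_on _ FX; exact: X1.
  have [XY|YX] := F_tot _ _ FX FY.
    by have [_] := F_on _ FY; apply=> //; exact: XY.
  by have [_] := F_on _ FX; apply=> //; exact: YX.
exists B; split=> // x xB; apply: contrapT => /eqP x0.
pose e := ((nm x)^-1)%:C *: x.
have e1 : ip e e = 1.
  rewrite ipxx sqZ normc_real ger0_norm ?invr_ge0 ?nm_ge0 // exprVn nm_sqr.
  by rewrite mulVf // gt_eqF // sq_gt0.
have eB f : B f -> ip e f = 0 by move=> Bf; rewrite /e ipZl xB ?mulr0.
have nBe : ~ B e by move=> /eB; rewrite e1 => /eqP; rewrite oner_eq0.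
apply: (B_max (e |` B)); first by split=> [f Bf|h]; [right|apply/nBe/h; left].
split=> [f [->//|/B1//]|f g [->|Bf] [->|Bg] fg].
- by case: fg.
- exact: eB.
- exact/ip_conj0/eB.
- exact: B0.
Qed.

Lemma hilbert_basisP : orthonormal_basis ip (hilbert_basis ip).
Proof.
by have [B hB] := orthonormal_basis_exists; exact: (xgetI set0 hB).
Qed.

Local Notation HB := (hilbert_basis ip).

Lemma hilbert_basis_norm e : HB e -> ip e e = 1.
Proof. by have [h _ _] := hilbert_basisP; exact: h. Qed.
Lemma hilbert_basis_orth e f : HB e -> HB f -> e != f -> ip e f = 0.
Proof. by have [_ h _] := hilbert_basisP => ? ? /eqP; exact: h. Qed.
Lemma hilbert_basis_total x : (forall e, HB e -> ip x e = 0) -> x = 0.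
Proof. by have [_ _ h] := hilbert_basisP; exact: h. Qed.

(** Duplicate-free lists of basis vectors index the finite partial sums. *)
Definition basis_seq s := uniq s /\ forall e, e \in s -> HB e.

Definition proj s x : H := \sum_(e <- s) ip x e *: e.
Definition coefs s x : R := \sum_(e <- s) normc (ip x e) ^+ 2.

Lemma ip_suml I (r : seq I) (F : I -> H) y :
  ip (\sum_(i <- r) F i) y = \sum_(i <- r) ip (F i) y.
Proof.
elim: r => [|i r IH]; first by rewrite !big_nil ip0l.
by rewrite !big_cons ipDl IH.
Qed.

Lemma basis_seq_cons e s : basis_seq (e :: s) <->
  [/\ e \notin s, HB e & basis_seq s].
Proof.
rewrite /basis_seq /=; split=> [[/andP[es us] h]|[es He [us h]]].
  split=> //; first by apply: h; rewrite mem_head.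
  by split=> // f fs; apply: h; rewrite inE fs orbT.
by split; [rewrite es|move=> f; rewrite inE => /orP[/eqP->|/h]].
Qed.

Lemma ip_proj_out s x e : basis_seq s -> HB e -> e \notin s ->
  ip (proj s x) e = 0.
Proof.
move=> [_ hs] He es; rewrite ip_suml big_seq big1 // => f fs.
have fe : f != e by apply: contraNneq es => <-.
by rewrite ipZl (hilbert_basis_orth (hs _ fs) He fe) mulr0.
Qed.

Lemma ip_proj_in s x e : basis_seq s -> e \in s -> ip (proj s x) e = ip x e.
Proof.
elim: s => [//|f s IH] /basis_seq_cons[fs Hf hs].
rewrite inE /proj big_cons ipDl ipZl -/(proj s x) => /orP[/eqP->|es].
  by rewrite hilbert_basis_norm // mulr1 ip_proj_out ?addr0.
have fe : f != e by apply: contraNneq fs => ->.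
have He : HB e by case: hs => _; exact.
by rewrite IH // (hilbert_basis_orth Hf He fe) mulr0 add0r.
Qed.

Lemma ip_projr s x y :
  ip y (proj s x) = \sum_(e <- s) (ip x e)^*%R * ip y e.
Proof.
rewrite ipC ip_suml rmorph_sum; apply: eq_bigr => e _.
by rewrite ipZl (ipC ip e y) rmorphM.
Qed.

Lemma ip_proj_coefs s x y : basis_seq s ->
  (forall e, e \in s -> ip y e = ip x e) -> ip y (proj s x) = (coefs s x)%:C.
Proof.
move=> hs hy; rewrite ip_projr rmorph_sum big_seq [RHS]big_seq.
by apply: eq_bigr => e es; rewrite hy // mulrC mulcJ.
Qed.

Lemma sq_proj s x : basis_seq s -> sq (proj s x) = coefs s x.
Proof.
by move=> hs; rewrite /sq (@ip_proj_coefs s x) // => e es; exact: ip_proj_in.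
Qed.

Lemma sq_sub_proj s x : basis_seq s -> sq (x - proj s x) = sq x - coefs s x.
Proof.
move=> hs; rewrite sqB sq_proj // (@ip_proj_coefs s x) //=; ring.
Qed.

Lemma bessel s x : basis_seq s -> coefs s x <= sq x.
Proof. by move=> hs; rewrite -subr_ge0 -sq_sub_proj ?sq_ge0. Qed.

Lemma sq_proj_sub s t x : basis_seq s -> basis_seq t -> {subset s <= t} ->
  sq (proj t x - proj s x) = coefs t x - coefs s x.
Proof.
move=> hs ht st; rewrite sqB !sq_proj // (@ip_proj_coefs s x) //=; first ring.
by move=> e /st; exact: ip_proj_in.
Qed.

(** Choose finite sets of basis vectors whose sums of squared coefficients
    approach the supremum [S] of all such sums.  The corresponding partial
    expansions of [x] form a Cauchy sequence, and each coefficient of [x] minus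
    its limit is bounded by what is left up to [S], hence vanishes. *)
Lemma proj_dense x (d : R) : 0 < d ->
  exists2 s, basis_seq s & nm (x - proj s x) < d.
Proof.
pose E := [set coefs s x | s in basis_seq].
have supE : has_sup E.
  split; first by exists (coefs [::] x), [::].
  by exists (sq x) => _ [s hs <-]; exact: bessel.
pose S := sup E.
have leS s : basis_seq s -> coefs s x <= S.
  by move=> hs; apply: ub_le_sup; [case: supE|exists s].
have nearS (r : R) : 0 < r -> exists2 s, basis_seq s & S - coefs s x < r.
  move=> r0; have [_ [s hs <-] h] := sup_adherent r0 supE.
  by exists s => //; move: h; rewrite -/S; lra.
have /choice[f hf] : forall n, exists s,
    basis_seq s /\ S - coefs s x < (n.+1%:R)^-1 ^+ 2.
  move=> n; have [|s ? ?] := nearS ((n.+1%:R)^-1 ^+ 2); last by exists s.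
  by rewrite exprn_gt0 // invr_gt0.
have f_dist s n : basis_seq s ->
    nm (proj s x - proj (f n) x) <= Num.sqrt (S - coefs s x) + (n.+1%:R)^-1.
  move=> hs; have [hn sn] := hf n.
  pose w := undup (s ++ f n).
  have hw : basis_seq w.
    split; first exact: undup_uniq.
    move=> e; rewrite mem_undup mem_cat => /orP[].
      by case: hs => _; exact.
    by case: hn => _; exact.
  (* Both projections are compared with the one for the union [w]. *)
  have -> : proj s x - proj (f n) x =
    (proj w x - proj (f n) x) - (proj w x - proj s x) 
    by rewrite opprB [RHS]addrC subrKA.
  apply: (le_trans (nm_triangleB _ _ _)); rewrite addrC; apply: lerD.
    rewrite /nm sq_proj_sub // ?ler_wsqrtr ?lerD2r ?leS // => e es.
    by rewrite mem_undup mem_cat es.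
  rewrite -[leRHS]ger0_norm ?invr_ge0 // -sqrtr_sqr ler_wsqrtr //.
  rewrite sq_proj_sub //; first by apply: le_trans (ltW sn); rewrite lerD2r leS.
  by move=> e es; rewrite mem_undup mem_cat es orbT.
have invn (r : R) : 0 < r -> exists N, forall n, (N <= n)%N -> (n.+1%:R)^-1 < r.
  move=> r0; exists (Num.truncn r^-1) => n Nn.
  rewrite invf_plt ?posrE // (lt_le_trans (truncnS_gt _)) //.
  by rewrite ler_nat ltnS.
have [|l hl] := hilbert_complete ip_norm (u := fun n => proj (f n) x).
  move=> r r0; have [N hN] := invn (r / 2) ltac:(lra).
  exists N => m n Nm Nn; have [hm sm] := hf m.
  apply: (le_lt_trans (f_dist _ n hm)).
  have := hN _ Nm; have := hN _ Nn.
  have : Num.sqrt (S - coefs (f m) x) <= (m.+1%:R)^-1.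
    rewrite -[leRHS]ger0_norm ?invr_ge0 // -sqrtr_sqr ler_wsqrtr //; exact: ltW.
  move: (Num.sqrt _) (m.+1%:R^-1) (n.+1%:R^-1) => a b c; lra.
have xl : x = l.
  apply/eqP; rewrite -subr_eq0; apply/eqP/hilbert_basis_total => e He.
  apply/eqP; rewrite -normc_eq0 eq_le normc_ge0 andbT.
  apply/ler_addgt0Pr => r r0; rewrite add0r.
  have [N1 h1] := hl (r / 2) ltac:(lra); have [N2 h2] := invn (r / 2) ltac:(lra).
  pose n := maxn N1 N2.
  have := h1 n (leq_maxl _ _); have := h2 n (leq_maxr _ _) => k2 k1.
  have [hn sn] := hf n.
  have p1 : normc (ip (x - proj (f n) x) e) <= (n.+1%:R)^-1.
    have [es|es] := boolP (e \in f n).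
      by rewrite ipDl ipNl ip_proj_in // subrr Normc.normc0 invr_ge0.
    rewrite ipDl ipNl ip_proj_out // subr0.
    rewrite -(ler_pXn2r (_ : (0 < 2)%N)) ?nnegrE ?normc_ge0 ?invr_ge0 //.
    apply: (le_trans _ (ltW sn)).
    have := leS (e :: f n); rewrite basis_seq_cons /coefs big_cons => h.
    by rewrite lerBrDr; apply: h.
  have -> : ip (x - l) e = ip (x - proj (f n) x) e + ip (proj (f n) x - l) e.
    by rewrite -ipDl subrKA.
  apply: (le_trans (@le_normcD _ _ _)).
  have := cauchy_schwarz ip (proj (f n) x - l) e.
  have -> : nm e = 1 by rewrite /nm /sq hilbert_basis_norm // sqrtr1.
  rewrite mulr1; move: p1 k1 k2; move: (normc _) (normc _) (n.+1%:R^-1) (nm _).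
  move=> a b c a' *; lra.
move=> d0; have [N hN] := hl _ d0; have [hn _] := hf N.
by exists (f N) => //; rewrite nm_distC {2}xl hN.
Qed.

Lemma parseval_dense x (r : R) : 0 < r ->
  exists2 s, basis_seq s & sq x < coefs s x + r.
Proof.
move=> r0; have [|s hs h] := @proj_dense x (Num.sqrt r).
  by rewrite sqrtr_gt0.
exists s => //; have := sq_sub_proj x hs.
have : sq (x - proj s x) < r.
  rewrite -nm_sqr -(sqr_sqrtr (ltW r0)) ltr_pXn2r ?nnegrE ?nm_ge0 ?sqrtr_ge0 //.
lra.
Qed.

End OrthonormalBases.

(** * Traces and fidelities with rank one operators *)

Section TraceClass.
Context {R : realType} {H : completeNormedModType R[i]}.
Variable ip : {dot H for Num.conj}.
Hypothesis ip_norm : forall x : H, `|x| ^+ 2 = ip x x.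
Implicit Types (x y z e : H) (A B S : H -> H) (s : seq H).
Local Notation nm := (nm ip).
Local Notation sq := (sq ip).
Local Notation qform := (qform ip).
Local Notation trace := (trace ip).
Local Notation HB := (hilbert_basis ip).
Local Notation basis_seq := (basis_seq ip).

Definition tr A : R := fine (trace A).

Lemma trace_ge_sum A s : basis_seq s ->
  ((\sum_(e <- s) qform A e)%:E <= trace A)%E.
Proof.
move=> [us hs]; apply: esum_ge; exists [set` s] => //=.
  split=> [|e /= /hs //]; exact: finite_seq.
by rewrite -fsbig_seq //= -sumEFin.
Qed.

Lemma trace_le A (K : R) :
  (forall s, basis_seq s -> \sum_(e <- s) qform A e <= K) ->
  (trace A <= K%:E)%E.
Proof.
move=> hK; apply: ge_ereal_sup => _ [F [F_fin F_HB] <-].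
rewrite fsbig_finite //= sumEFin lee_fin; apply: hK; split=> [|e].
  exact: finmap.fset_uniq.
by rewrite in_fset_set // inE => /F_HB.
Qed.


Lemma trace_nneg A : (0 <= trace A)%E.
Proof. by have := @trace_ge_sum A [::]; rewrite big_nil; apply. Qed.

Lemma tr_ge0 A : 0 <= tr A.
Proof. exact/fine_ge0/trace_nneg. Qed.

Lemma tr_fin A : (trace A < +oo)%E -> trace A = (tr A)%:E.
Proof.
by move=> h; rewrite /tr fineK // ge0_fin_numE // trace_nneg.
Qed.

Lemma tr_ge_sum A s : (trace A < +oo)%E -> basis_seq s ->
  \sum_(e <- s) qform A e <= tr A.
Proof. by move=> fA hs; rewrite -lee_fin -tr_fin //; exact: trace_ge_sum. Qed.

Lemma tr_le A (K : R) :
  (forall s, basis_seq s -> \sum_(e <- s) qform A e <= K) ->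
  (trace A < +oo)%E /\ tr A <= K.
Proof.
move=> /trace_le h; have fA : (trace A < +oo)%E by apply: (le_lt_trans h); rewrite ltry.
by split=> //; rewrite -lee_fin -tr_fin.
Qed.

Lemma trZ (a : R) A : 0 < a -> (trace A < +oo)%E ->
  (trace (fun x => a%:C *: A x) < +oo)%E /\
  tr (fun x => a%:C *: A x) = a * tr A.
Proof.
move=> a0 fA.
have sumZ s : \sum_(e <- s) qform (fun x => a%:C *: A x) e
    = a * \sum_(e <- s) qform A e.
  rewrite mulr_sumr; apply: eq_bigr => e _.
  by rewrite /qform ipZl cReM /= mul0r subr0.
have [|fZ leZ] := @tr_le (fun x => a%:C *: A x) (a * tr A).
  by move=> s hs; rewrite sumZ ler_pM2l // tr_ge_sum.
split=> //; apply/eqP; rewrite eq_le leZ /= mulrC -ler_pdivlMr //.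
have [|//] := @tr_le A (tr (fun x => a%:C *: A x) / a).
by move=> s hs; rewrite ler_pdivlMr // mulrC -sumZ tr_ge_sum.
Qed.

Lemma tr0 : tr (fun=> 0) = 0.
Proof.
have [|_ h] := @tr_le (fun=> 0) 0; last by apply/eqP; rewrite eq_le h tr_ge0.
by move=> s _; rewrite big1 // => e _; rewrite /qform ip0l.
Qed.

(** Boundedness by the trace: expand [x] in the basis; by Cauchy-Schwarz for
    the form of [A], a finite part [p] of the expansion satisfies
    [<Ap,p> <= (|x|^2 t + <Ap,p>) / 2]. *)
Lemma qform_le_tr A x : positive_operator ip A -> (trace A < +oo)%E ->
  qform A x <= tr A * sq x.
Proof.
move=> posA fA; have [[lA _] pA] := posA.
have finite (t : R) s : 0 < t -> tr A <= t -> basis_seq s ->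
    qform A (proj ip s x) <= t * sq x.
  move=> t0 At hs; set p := proj ip s x.
  have sum_q : \sum_(e <- s) normc (ip (A p) e) ^+ 2 <= qform A p * t.
    apply: (@le_trans _ _ (\sum_(e <- s) qform A p * qform A e)).
      by apply: ler_sum => e _; exact: positive_CS.
    rewrite -mulr_sumr ler_wpM2l ?(qform_ge0 pA) //.
    exact: le_trans (tr_ge_sum fA hs) At.
  have : qform A p <=
      \sum_(e <- s) 2^-1 * (t * normc (ip x e) ^+ 2 +
                            t^-1 * normc (ip (A p) e) ^+ 2).
    rewrite {1}/qform {2}/p ip_projr.
    have -> : Re (\sum_(e <- s) (ip x e)^*%R * ip (A p) e) =
       \sum_(e <- s) Re ((ip x e)^*%R * ip (A p) e).
      by elim: (s) => [|e r IH]; rewrite ?big_nil // !big_cons cReD IH.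
    apply: ler_sum => e _; apply: (le_trans (Re_le_normc _)).
    rewrite Normc.normcM normc_conj.
    move: (normc (ip x e)) (normc (ip (A p) e)) => a b.
    have := sqr_ge0 (t * a - b); rewrite -(@pmulr_lge0 _ t^-1) ?invr_gt0 //.
    have -> : (t * a - b) ^+ 2 / t = t * a ^+ 2 + t^-1 * b ^+ 2 - 2 * (a * b).
      by field; rewrite gt_eqF.
    lra.
  rewrite -mulr_sumr big_split /= -!mulr_sumr -/(coefs ip s x) => h.
  have bs : t * coefs ip s x <= t * sq x by rewrite ler_pM2l // bessel.
  have : t^-1 * (\sum_(e <- s) normc (ip (A p) e) ^+ 2) <= qform A p.
    by rewrite mulrC ler_pdivrMr.
  lra.
(* The factor [t] exceeds the trace by an amount that costs at most [r / 2],
   and [x - p] is so small that the change of the form also costs [r / 2]. *)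
have [/(bounded_operatorP ip_norm)[_ [M M0 A_bd]] _] := posA.
apply/ler_addgt0Pr => r r0.
have k0 : 0 < 1 + sq x by rewrite ltr_pwDl ?sq_ge0.
pose t := tr A + r / 2 / (1 + sq x).
have rk : 0 < r / 2 / (1 + sq x) by rewrite !divr_gt0.
have t0 : 0 < t by rewrite ltr_wpDl ?tr_ge0.
pose m := 2 * M * nm x + 1.
have m0 : 0 < m by rewrite ltr_wpDl // !mulr_ge0 ?nm_ge0.
have [s hs hd] := proj_dense ip_norm x (divr_gt0 r0 (mulr_gt0 (ltr0Sn _ 1) m0)).
have := finite t s t0 _ hs; rewrite /t lerDl (ltW rk) => /(_ isT).
set p := proj ip s x in hd *; set w := x - p in hd *.
have np : nm p <= nm x by rewrite ler_wsqrtr // sq_proj // bessel.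
have ex : qform A x = qform A p + (Re (ip (A x) w) + Re (ip (A w) p)).
  have -> : ip (A x) w = ip (A x) x - ip (A x) p by rewrite /w ipDr ipNr.
  have -> : ip (A w) p = ip (A x) p - ip (A p) p.
    by rewrite /w (linB lA) ipDl ipNl.
  rewrite /qform !(cReD, cReN); ring.
have b1 : Re (ip (A x) w) <= M * nm x * nm w.
  apply: (le_trans (Re_le_normc _)); apply: (le_trans (cauchy_schwarz _ _ _)).
  by rewrite ler_wpM2r ?nm_ge0.
have b2 : Re (ip (A w) p) <= M * nm x * nm w.
  apply: (le_trans (Re_le_normc _)); apply: (le_trans (cauchy_schwarz _ _ _)).
  rewrite mulrAC; apply: ler_pM; rewrite ?nm_ge0 //; exact: A_bd.
have b3 : m * nm w <= r / 2.
  have := ltW hd; rewrite invfM mulrA ler_pdivlMr // mulrC; exact.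
have b4 : r / 2 / (1 + sq x) * sq x <= r / 2.
  by rewrite mulrAC ler_pdivrMr // ler_pM2l ?divr_gt0 // lerDr.
rewrite ex mulrDl; move: b1 b2 b3 b4; rewrite /m.
have := nm_ge0 ip w; nra.
Qed.

Lemma adjoint_eq A B : (forall x y, ip (A x) y = ip x (B y)) ->
  adjoint ip A = B.
Proof.
move=> AB; rewrite /adjoint.
have := @xgetI _ (fun=> 0) [set B | forall x y, ip (A x) y = ip x (B y)] B AB.
set C := xget _ _ => AC; apply/funext => y.
by apply: (ip_left_inj (ip := ip)) => z; rewrite (ipC ip z) -AC AB -ipC.
Qed.

(** A positive operator is its own absolute value. *)
Lemma positive_trace_classP A : positive_trace_class ip A <->
  positive_operator ip A /\ (trace A < +oo)%E.
Proof.
rewrite /positive_trace_class /trace_class /absolute_value /=.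
split=> [[[bA fA] posA]|[posA fA]].
  split=> //; move: fA.
  by rewrite (adjoint_eq (positive_sa posA)) (operator_sqrt_eq ip_norm posA).
split=> //; split; first by case: posA.
by rewrite (adjoint_eq (positive_sa posA)) (operator_sqrt_eq ip_norm posA).
Qed.

(** The operator [x] tensor [x], a multiple of the projection onto [x]. *)
Definition rank_one x : H -> H := fun w => ip w x *: x.

Lemma qform_rank_one x w : qform (rank_one x) w = normc (ip w x) ^+ 2.
Proof. by rewrite /qform ipZl (ipC ip w x) mulcJ. Qed.

Lemma rank_one_pos x : positive_operator ip (rank_one x).
Proof.
split; last first.
  by move=> w; rewrite ipZl (ipC ip w x) mulcJ ler0c sqr_ge0.
apply/(bounded_operatorP ip_norm); split.
  by move=> c u v; rewrite /rank_one ipDl ipZl scalerDl scalerA.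
exists (sq x) => [|w]; first exact: sq_ge0.
rewrite /rank_one nmZ -nm_sqr expr2 mulrC -mulrA ler_wpM2l ?nm_ge0 //.
by rewrite mulrC cauchy_schwarz.
Qed.

Lemma rank_one_tr x : (trace (rank_one x) < +oo)%E /\ tr (rank_one x) = sq x.
Proof.
have sumE s : \sum_(e <- s) qform (rank_one x) e = coefs ip s x.
  by apply: eq_bigr => e _; rewrite qform_rank_one (ipC ip x e) normc_conj.
have [s hs|fx le_x] := @tr_le (rank_one x) (sq x).
  by rewrite sumE bessel.
split=> //; apply/eqP; rewrite eq_le le_x /=; apply/ler_addgt0Pr => r r0.
have [s hs h] := parseval_dense ip_norm x r0.
by apply: (le_trans (ltW h)); rewrite lerD2r -sumE tr_ge_sum.
Qed.

Lemma rank_one_class x : positive_trace_class ip (rank_one x).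
Proof.
by apply/positive_trace_classP; split; [exact: rank_one_pos|case: (rank_one_tr x)].
Qed.

Lemma sqrt_scaled_rank_one (a : R) x : 0 <= a ->
  operator_sqrt ip (fun w => (a ^+ 2 * sq x)%:C *: rank_one x w) =
  (fun w => a%:C *: rank_one x w).
Proof.
move=> a0; apply: operator_sqrt_eq => //; first exact: positiveZ (rank_one_pos x).
move=> w; rewrite /rank_one !scalerA; congr (_ *: _).
by rewrite !ipZl ipxx !rmorphM /=; ring.
Qed.

Lemma tr_scaled_rank_one (a : R) x : 0 <= a ->
  tr (fun w => a%:C *: rank_one x w) = a * sq x.
Proof.
rewrite le_eqVlt => /orP[/eqP <-|a0].
  rewrite mul0r -[RHS]tr0; congr tr; apply/funext => w.
  exact: scale0r.
have [fx <-] := rank_one_tr x; by have [] := trZ a0 fx.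
Qed.

Lemma sqrt_rank_one x :
  operator_sqrt ip (rank_one x) = (fun w => ((nm x)^-1)%:C *: rank_one x w).
Proof.
have n0 : 0 <= (nm x)^-1 by rewrite invr_ge0 nm_ge0.
rewrite -(sqrt_scaled_rank_one x n0); congr operator_sqrt; apply/funext => w.
have [->|x0] := eqVneq x 0; first by rewrite /rank_one !scaler0.
by rewrite exprVn nm_sqr mulVf ?scale1r // gt_eqF // sq_gt0.
Qed.

(** Since [rank_one x \o A \o rank_one x] is [<Ax,x>] times [rank_one x], both
    square roots in the fidelity are explicit multiples of [rank_one x]. *)
Lemma fidelity_rank_one_l x A : positive_operator ip A ->
  fidelity ip (rank_one x) A = Num.sqrt (qform A x).
Proof.
move=> posA; have [[lA _] pA] := posA.
have [->|x0] := eqVneq x 0.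
  have e0 : rank_one 0 = (fun=> 0) by apply/funext => w; rewrite /rank_one scaler0.
  rewrite /fidelity sqrt_rank_one e0 /qform ip0r sqrtr0.
  rewrite -/(tr _) -[RHS]tr0; congr tr.
  apply: operator_sqrt_eq => // [|w]; last by rewrite /= scaler0.
  by rewrite -e0; exact: rank_one_pos.
have n0 : 0 < nm x by exact: nm_gt0.
pose a := Num.sqrt (qform A x) / sq x.
have a0 : 0 <= a by rewrite divr_ge0 ?sqrtr_ge0 ?sq_ge0.
rewrite /fidelity sqrt_rank_one.
have -> : (fun w => ((nm x)^-1)%:C *: rank_one x w) \o A \o
          (fun w => ((nm x)^-1)%:C *: rank_one x w)
  = (fun w => (a ^+ 2 * sq x)%:C *: rank_one x w).
  apply/funext => w; rewrite /= /rank_one !(linZ lA) !scalerA; congr (_ *: _).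
  rewrite !ipZl (ip_qform pA) /a exprMn exprVn sqr_sqrtr ?(qform_ge0 pA) //.
  rewrite -nm_sqr; have nC : (nm x)%:C != 0 by rewrite fmorph_eq0 gt_eqF.
  by rewrite !(rmorphM, rmorphXn, fmorphV) /=; field.
rewrite sqrt_scaled_rank_one // -/(tr _) tr_scaled_rank_one // /a divfK //.
by rewrite gt_eqF // sq_gt0.
Qed.

(** With [S] the square root of [A], the operator [S \o rank_one x \o S] is
    [rank_one (S x)]. *)
Lemma fidelity_rank_one_r x A : positive_operator ip A ->
  fidelity ip A (rank_one x) = Num.sqrt (qform A x).
Proof.
move=> posA; have [posS SS] := operator_sqrtP ip_norm posA.
rewrite /fidelity; set S := operator_sqrt ip A in posS SS *.
have lS := positive_lin posS.
have -> : S \o rank_one x \o S = rank_one (S x).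
  by apply/funext => w; rewrite /= /rank_one (linZ lS) (positive_sa posS).
have -> : qform A x = sq (S x) by rewrite /qform -SS (positive_sa posS).
rewrite sqrt_rank_one -/(tr _) tr_scaled_rank_one ?invr_ge0 ?nm_ge0 //.
have [->|x0] := eqVneq (S x) 0.
  by rewrite (_ : sq 0 = 0) ?mulr0 ?sqrtr0 //; apply/(sq0P ip).
by rewrite -/(nm _) -nm_sqr expr2 mulKf // gt_eqF // nm_gt0.
Qed.

End TraceClass.

(** * Metric characterisation of the rank one operators *)

Section BuresMetric.
Context {R : realType} {H : completeNormedModType R[i]}.
Variable ip : {dot H for Num.conj}.
Hypothesis ip_norm : forall x : H, `|x| ^+ 2 = ip x x.
Local Notation nm := (nm ip).
Local Notation sq := (sq ip).
Local Notation qform := (qform ip).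
Local Notation tr := (tr ip).
Local Notation F := (fidelity ip).
Local Notation dist := (bures_distance ip).
Local Notation cone := (positive_trace_class ip).
Local Notation rank_one := (rank_one ip).
Implicit Types (A B C : cone) (x y z w u : H).

Lemma cone_eq A B : val A = val B -> A = B.
Proof. exact: val_inj. Qed.

Lemma cone_pos A : positive_operator ip (val A).
Proof. by have /(positive_trace_classP ip_norm)[] := set_valP A. Qed.

Lemma cone_tr A : (trace ip (val A) < +oo)%E.
Proof. by have /(positive_trace_classP ip_norm)[] := set_valP A. Qed.

Lemma cone_form A x : 0 <= ip (val A x) x.
Proof. by have [_] := cone_pos A. Qed.

Lemma cone_lin A : linear (val A).
Proof. exact: positive_lin (cone_pos A). Qed.

Definition cone_of (f : H -> H) (hf : cone f) : cone := exist _ f (mem_set hf).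

Definition ray x : cone := cone_of (rank_one_class ip_norm x).

Lemma tr_ray x : tr (val (ray x)) = sq x.
Proof. by have [] := rank_one_tr ip_norm x. Qed.

Lemma ray0 : val (ray 0) = fun=> 0.
Proof. by apply/funext => w; rewrite /= /rank_one scaler0. Qed.

Lemma cone_tr0 A : tr (val A) = 0 -> A = ray 0.
Proof.
move=> A0; apply: cone_eq; rewrite ray0; apply/funext => x.
apply: (qform_eq0 (cone_lin A) (cone_form A)); apply/eqP; rewrite eq_le.
have := qform_le_tr ip_norm x (cone_pos A) (cone_tr A).
by rewrite A0 mul0r => ->; rewrite (qform_ge0 (cone_form A)).
Qed.

Lemma fidelity_ge0 (f g : H -> H) : 0 <= F f g.
Proof. exact: tr_ge0. Qed.

(** Twice the fidelity, unless the fidelity exceeds the mean of the traces, in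
    which case the square root in the metric is cut off at zero and [overlap]
    is the sum of the traces. *)
Definition overlap A B : R := tr (val A) + tr (val B) - dist (val A) (val B) ^+ 2.

Lemma overlapE A B :
  overlap A B = Num.min (2 * F (val A) (val B)) (tr (val A) + tr (val B)).
Proof.
rewrite /overlap /bures_distance -!/(tr _).
set t := tr _ + tr _; set f := 2 * _.
have [h|h] := leP f t.
  by rewrite sqr_sqrtr ?subr_ge0 // opprB addrC subrK.
by rewrite ler0_sqrtr ?expr0n ?subr0 // subr_le0 ltW.
Qed.

Lemma amgm (a b c : R) : 0 <= a -> 0 <= b -> c <= a * b ->
  2 * Num.sqrt c <= a + b.
Proof.
move=> a0 b0 cab.
have : Num.sqrt c <= Num.sqrt (((a + b) / 2) ^+ 2).
  by apply: ler_wsqrtr; have := sqr_ge0 (a - b); nra.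
rewrite sqrtr_sqr ger0_norm ?divr_ge0 ?addr_ge0 //; lra.
Qed.

Lemma overlap_ray_l x A : overlap (ray x) A = 2 * Num.sqrt (qform (val A) x).
Proof.
rewrite overlapE (fidelity_rank_one_l ip_norm x (cone_pos A)).
apply/min_idPl/amgm; rewrite ?tr_ge0 // mulrC tr_ray.
exact: (qform_le_tr ip_norm x (cone_pos A) (cone_tr A)).
Qed.

Lemma overlap_ray_r x A : overlap A (ray x) = 2 * Num.sqrt (qform (val A) x).
Proof.
rewrite overlapE (fidelity_rank_one_r ip_norm x (cone_pos A)).
apply/min_idPl/amgm; rewrite ?tr_ge0 // tr_ray.
exact: (qform_le_tr ip_norm x (cone_pos A) (cone_tr A)).
Qed.

Lemma overlap_ge0 A B : 0 <= overlap A B.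
Proof.
by rewrite overlapE le_min mulr_ge0 ?fidelity_ge0 // addr_ge0 ?tr_ge0.
Qed.

Lemma dist_sqr A B : dist (val A) (val B) ^+ 2 =
  tr (val A) + tr (val B) - overlap A B.
Proof. by rewrite /overlap opprB addrC subrK. Qed.

Lemma overlap0l A : overlap (ray 0) A = 0.
Proof. by rewrite overlap_ray_l /qform ip0r sqrtr0 mulr0. Qed.

Lemma overlap0r A : overlap A (ray 0) = 0.
Proof. by rewrite overlap_ray_r /qform ip0r sqrtr0 mulr0. Qed.

Lemma tr_dist0 A : tr (val A) = dist (val A) (val (ray 0)) ^+ 2.
Proof.
rewrite dist_sqr overlap0r tr_ray (_ : sq 0 = 0) ?addr0 ?subr0 //.
exact/(sq0P ip).
Qed.

Definition midpoint C A B :=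
  dist (val A) (val B) ^+ 2 = 4 * dist (val C) (val A) ^+ 2 /\
  dist (val A) (val B) ^+ 2 = 4 * dist (val C) (val B) ^+ 2.

Lemma sq0 : sq 0 = 0.
Proof. exact/(sq0P ip). Qed.

(** If 0 is a midpoint of [A] and [B] then [4 tr A = 4 tr B = d(A,B)^2], which
    is at most [tr A + tr B] because the fidelity is nonnegative. *)
Lemma zero_not_midpoint A B : midpoint (ray 0) A B -> A = B.
Proof.
rewrite /midpoint !dist_sqr !overlap0l tr_ray sq0 => -[h1 h2].
have := overlap_ge0 A B; have := tr_ge0 ip (val A); have := tr_ge0 ip (val B).
move=> h3 h4 h5; have A0 : tr (val A) = 0 by lra.
have B0 : tr (val B) = 0 by lra.
by rewrite (cone_tr0 A0) (cone_tr0 B0).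
Qed.

Lemma cone_scale4 A : cone (fun x => 4%:C *: val A x).
Proof.
apply/(positive_trace_classP ip_norm); split.
  by apply: positiveZ (cone_pos A).
by have [] := @trZ _ _ ip 4 (val A) _ (cone_tr A).
Qed.

Lemma fidelity_scale4 A :
  F (val A) (val (cone_of (cone_scale4 A))) = 2 * tr (val A).
Proof.
have [posS SS] := operator_sqrtP ip_norm (cone_pos A).
rewrite /fidelity; set S := operator_sqrt ip _ in posS SS *.
have lS := positive_lin posS.
have [] := @trZ _ _ ip 2 (val A) _ (cone_tr A) => // _ <-.
congr tr; apply: operator_sqrt_eq => //; first exact: positiveZ (cone_pos A).
move=> x; rewrite /= (linZ (cone_lin A)) (linZ lS) scalerA -rmorphM /=.
by rewrite -!SS; congr (_%:C *: _); rewrite -natrM.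
Qed.

(** The midpoint of 0 and [4 A] is [A], as [F(A,4A) = 2 tr A]. *)
Lemma nonzero_midpoint A : A <> ray 0 -> exists B C, midpoint A B C /\ B <> C.
Proof.
move=> A0; exists (ray 0), (cone_of (cone_scale4 A)).
have t4 : tr (val (cone_of (cone_scale4 A))) = 4 * tr (val A).
  by have [] := @trZ _ _ ip 4 (val A) _ (cone_tr A).
have A1 : tr (val A) != 0 by apply/eqP => /cone_tr0.
split; last first.
  move=> e; move: t4; rewrite -e tr_ray sq0 => /esym/eqP.
  by rewrite mulf_eq0 pnatr_eq0 (negbTE A1).
have := tr_ge0 ip (val A) => tA.
rewrite /midpoint !dist_sqr !overlap0l overlap0r tr_ray sq0 t4.
rewrite overlapE fidelity_scale4 t4 min_l; [|lra]; split; ring.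
Qed.

(** A comparison of [B] with [A] in terms of the metric alone.  The first
    alternative covers every [C] for which the trace in [F(A,C)] would be
    infinite, as [fine] then returns 0; where it fails, that trace is finite
    and bounds the operator of which it is the trace. *)
Definition dominated B A :=
  forall C, overlap A C = 0 \/ overlap B C <= overlap A C.

Lemma both_signs (q p s t : R) :
  q + p + s <= t -> q - p + s <= t -> 0 <= s -> q <= t.
Proof. by lra. Qed.

(** Taking rank one operators for [C] gives the inequality at every [w] with
    [<Aw,w> <> 0].  At the other vectors it follows by continuity along
    [w + t u], where [<Au,u> <> 0]; adding the inequalities for [t] and [- t]
    removes the cross term. *)
Lemma dominated_le A B : A <> ray 0 -> dominated B A ->
  forall w, qform (val B) w <= qform (val A) w.
Proof.
move=> A0 BA.
have lA := cone_lin A; have lB := cone_lin B.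
have pA := cone_form A; have pB := cone_form B.
have test w : qform (val A) w <> 0 -> qform (val B) w <= qform (val A) w.
  move=> Aw; have := BA (ray w); rewrite !overlap_ray_r => -[/eqP|].
    rewrite mulf_eq0 pnatr_eq0 /= sqrtr_eq0 => h.
    by case: Aw; apply/eqP; rewrite eq_le h (qform_ge0 pA).
  by rewrite ler_pM2l // ler_sqrt // (qform_ge0 pA).
move=> w; have [Aw|/eqP Aw] := eqVneq (qform (val A) w) 0; last exact: test.
have [u Au] : exists u, qform (val A) u <> 0.
  apply: contrapT => h; apply: A0; apply: cone_eq; rewrite ray0.
  apply/funext => u; apply: (qform_eq0 lA pA); apply: contrapT => Au.
  by apply: h; exists u.
have Aw0 := qform_eq0 lA pA Aw.
have wA : ip (val A u) w = 0.
  by rewrite (positive_selfadjoint lA pA) Aw0 ip0r.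
set a := qform (val A) u in Au.
have qA (t : R) : qform (val A) (w + t%:C *: u) = t ^+ 2 * a.
  rewrite /qform (linD lA) (linZ lA) Aw0 add0r !ipE wA mulr0 add0r conjcR.
  by rewrite !cReM /= (_ : Re (ip (val A u) u) = a) //; ring.
have qB (t : R) : qform (val B) (w + t%:C *: u) = qform (val B) w
    + 2 * t * Re (ip (val B w) u) + t ^+ 2 * qform (val B) u.
  rewrite /qform (linD lB) (linZ lB) !ipE.
  rewrite (positive_selfadjoint lB pB u w) (ipC ip (val B w) u) conjcR.
  rewrite !ReIm /=; ring.
have bnd (t : R) : t != 0 -> qform (val B) w <= t ^+ 2 * a.
  move=> t0; have := test (w + t%:C *: u); have := test (w + (- t)%:C *: u).
  rewrite !qA !qB sqrrN mulrN mulNr => h1 h2.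
  have ta : t ^+ 2 * a <> 0.
    by apply/eqP; rewrite mulf_neq0 ?expf_neq0 //; apply/eqP.
  exact: both_signs (h2 ta) (h1 ta) (mulr_ge0 (sqr_ge0 t) (qform_ge0 pB u)).
have a0 : 0 < a.
  by rewrite lt_def (qform_ge0 pA) andbT; apply/eqP.
rewrite Aw; apply/ler_addgt0Pr => e e0; rewrite add0r.
have ea : 0 <= e / a by rewrite divr_ge0 // ltW.
have se : Num.sqrt (e / a) != 0 by rewrite gt_eqF // sqrtr_gt0 divr_gt0.
by have := bnd _ se; rewrite sqr_sqrtr // divfK // gt_eqF.
Qed.

(** If [S] is the square root of [√A C √A] and [y = √A u], then
    [<Cy,y> = |Su|^2], which is at most [(tr S)^2 |u|^2]. *)
Lemma range_dominated A u : sq u <= 1 ->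
  dominated (ray (operator_sqrt ip (val A) u)) A.
Proof.
move=> u1 C; have [ov0|/eqP ov0] := eqVneq (overlap A C) 0; first by left.
right; set y := operator_sqrt ip (val A) u.
have [posS SS] := operator_sqrtP ip_norm (cone_pos A).
have sqy : sq y = qform (val A) u.
  by rewrite /sq /y (positive_sa posS) SS -(positive_sa (cone_pos A)).
have yA : sq y <= tr (val A).
  rewrite sqy; apply: (le_trans (qform_le_tr ip_norm u (cone_pos A) (cone_tr A))).
  by rewrite ler_piMr ?tr_ge0.
rewrite [leRHS]overlapE le_min; apply/andP; split; last first.
  rewrite overlapE ge_min; apply/orP; right.
  by rewrite lerD2r tr_ray.
have F0 : F (val A) (val C) != 0.
  apply/eqP => h; apply: ov0; rewrite overlapE h mulr0 min_l //.
  by rewrite addr_ge0 ?tr_ge0.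
rewrite overlap_ray_l ler_pM2l //; move: F0; rewrite /fidelity.
set S := operator_sqrt ip (val A) in posS SS y sqy yA *.
have [posT TT] := operator_sqrtP ip_norm (positive_conj ip_norm posS (cone_pos C)).
set T := operator_sqrt ip _ in posT TT *; rewrite -/(tr T) => trT.
have fT : (trace ip T < +oo)%E.
  by rewrite ltey; apply: contra trT => /eqP h; rewrite /tr h.
have lT := positive_lin posT; have [_ pT] := posT.
have -> : qform (val C) y = sq (T u).
  by rewrite /sq (positive_sa posT) TT /= -(positive_sa posS) /qform
    (positive_sa (cone_pos C)).
rewrite -[tr T]ger0_norm ?tr_ge0 // -sqrtr_sqr ler_wsqrtr //.
have h1 := qform_le_tr ip_norm u posT fT.
have h2 := qform_le_tr ip_norm (T u) posT fT.
have := positive_CS lT pT u (T u); rewrite ipxx normc_real ger0_norm ?sq_ge0 //.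
have [->|/eqP z0] := eqVneq (T u) 0; first by rewrite sq0 sqr_ge0.
have Tu0 : 0 < sq (T u) by apply: sq_gt0; apply/eqP.
move=> h; rewrite -(ler_pM2r Tu0) -expr2; apply: (le_trans h).
rewrite [tr T ^+ 2]expr2 -mulrA; apply: ler_pM; rewrite ?(qform_ge0 pT) //.
by apply: (le_trans h1); rewrite ler_piMr ?tr_ge0.
Qed.

(** A property that singles out the rank one operators.  What a rank one
    operator dominates are multiples of it, which are told apart by their
    traces, whereas an operator of higher rank dominates rank one operators of
    equal trace in different directions. *)
Definition is_ray A := A <> ray 0 /\
  forall B B', dominated B A -> dominated B' A ->
    tr (val B) = tr (val B') -> B = B'.

(** A positive operator that vanishes on the orthogonal complement of [x] is a
    multiple of [rank_one x]: its range is orthogonal to its kernel. *)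
Lemma kernel_rank_one x (B : H -> H) : x <> 0 -> positive_operator ip B ->
  (forall w, ip w x = 0 -> B w = 0) ->
  forall w, B w = (qform B x / sq x / sq x)%:C *: rank_one x w.
Proof.
move=> x0 posB ker w; have [[lB _] pB] := posB.
have sx : 0 < sq x by apply/sq_gt0/eqP.
have B_on v : B v = (ip v x * ((sq x)^-1)%:C) *: B x.
  apply/eqP; rewrite -subr_eq0 -(linZ lB) -(linB lB); apply/eqP/ker.
  by rewrite !ipE ipxx -mulrA -rmorphM /= mulVf ?gt_eqF // mulr1 subrr.
have Bxx : B x = ((qform B x / sq x)%:C) *: x.
  apply: (ip_left_inj (ip := ip)) => z.
  rewrite (positive_selfadjoint lB pB) (B_on z) ipZr ipZl.
  rewrite conjcM conjcR -(ipC ip) -(positive_selfadjoint lB pB) (ip_qform pB).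
  by rewrite !rmorphM /=; ring.
rewrite (B_on w) Bxx /rank_one !scalerA; congr (_ *: _).
by rewrite !rmorphM /=; ring.
Qed.

Lemma dominated_ray x B : x <> 0 -> dominated B (ray x) ->
  forall w, val B w = (tr (val B) / sq x)%:C *: rank_one x w.
Proof.
move=> x0 Bx; have sx : 0 < sq x by apply/sq_gt0/eqP.
have rx : ray x <> ray 0.
  by move=> /(congr1 (fun A : cone => tr (val A))); rewrite !tr_ray sq0; lra.
have lB := cone_lin B; have pB := cone_form B.
have ker w : ip w x = 0 -> val B w = 0.
  move=> wx; apply: (qform_eq0 lB pB).
  have := dominated_le rx Bx w; rewrite qform_rank_one wx Normc.normc0 expr0n /=.
  by move=> h; apply/eqP; rewrite eq_le h (qform_ge0 pB).
have Bw := kernel_rank_one x0 (cone_pos B) ker.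
suff -> : tr (val B) = qform (val B) x / sq x by [].
rewrite (funext Bw : val B = _) tr_scaled_rank_one //; last first.
  by rewrite !divr_ge0 ?sq_ge0 ?(qform_ge0 pB).
by rewrite -(funext Bw : val B = _) divfK ?gt_eqF.
Qed.

Lemma ray_is_ray x : x <> 0 -> is_ray (ray x).
Proof.
move=> x0; split=> [|B B' Bx B'x t].
  move=> /(congr1 (fun A : cone => tr (val A))); rewrite !tr_ray sq0.
  by move=> /(sq0P ip).
apply: cone_eq; apply/funext => w.
by rewrite (dominated_ray x0 Bx) (dominated_ray x0 B'x) t.
Qed.

Lemma is_rayP A : is_ray A -> exists2 x, x <> 0 & A = ray x.
Proof.
move=> [A0 A_dom].
have [posS SS] := operator_sqrtP ip_norm (cone_pos A).
set S := operator_sqrt ip (val A) in posS SS.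
have lS := positive_lin posS; have [_ pS] := posS.
have unit_ball v : exists2 k : R, 0 < k & sq (k%:C *: v) <= 1.
  have k0 : 0 < 1 + nm v by rewrite ltr_wpDr ?nm_ge0.
  exists (1 + nm v)^-1; first by rewrite invr_gt0.
  rewrite sqZ normc_real gtr0_norm ?invr_gt0 // -nm_sqr -exprMn exprn_ile1 //.
    by rewrite mulr_ge0 ?nm_ge0 // invr_ge0 ltW.
  by rewrite mulrC ler_pdivrMr // mul1r lerDr.
have [u0 Su0] : exists u, S u <> 0.
  apply: contrapT => h; apply: A0; apply: cone_eq; rewrite ray0.
  apply/funext => u; rewrite -SS; apply: contrapT => SSu.
  by apply: h; exists (S u).
have [k0 k0p b0] := unit_ball u0.
set y := S u0 in Su0.
have ny : 0 < nm y by apply/nm_gt0/eqP.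
(* Short multiples of [y] and of [S v] come from the unit ball, so their rank
   one operators are dominated.  At a common length [m] the traces agree, and
   the two operators coincide. *)
have par v : exists c, S v = c *: y.
  have [Sv|Sv] := pselect (S v = 0); first by exists 0; rewrite scale0r.
  have nv : 0 < nm (S v) by apply/nm_gt0/eqP.
  have [k kp b] := unit_ball v.
  pose m := Num.min (k0 * nm y) (k * nm (S v)).
  have m0 : 0 < m by rewrite lt_min !mulr_gt0.
  have scaled w j : 0 < j -> sq (j%:C *: w) <= 1 -> 0 < nm (S w) ->
      m <= j * nm (S w) -> dominated (ray ((m / nm (S w))%:C *: S w)) A.
    move=> j0 jb nw mj; rewrite -(linZ lS); apply: range_dominated.
    apply: le_trans jb; rewrite !sqZ ler_wpM2r ?sq_ge0 // !normc_real.
    rewrite ler_pXn2r ?nnegrE ?normr_ge0 // !gtr0_norm ?divr_gt0 //.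
    by rewrite ler_pdivrMr.
  have d1 := scaled u0 k0 k0p b0 ny ltac:(by rewrite ge_min lexx).
  have d2 := scaled v k kp b nv ltac:(by rewrite ge_min lexx orbT).
  have sqm w : 0 < nm w -> sq ((m / nm w)%:C *: w) = m ^+ 2.
    move=> nw; rewrite sqZ normc_real gtr0_norm ?divr_gt0 //.
    by rewrite -nm_sqr -exprMn divfK ?gt_eqF.
  have := A_dom _ _ d1 d2; rewrite !tr_ray !sqm // => /(_ erefl).
  move=> /(congr1 (fun B : cone => val B (S v))) /=.
  rewrite /rank_one !ipZr ipxx !scalerA => e.
  have c0 : (m / nm (S v))%:C * (sq (S v))%:C * (m / nm (S v))%:C != 0 :> R[i].
    rewrite -!rmorphM fmorph_eq0 gt_eqF // !mulr_gt0 ?invr_gt0 //.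
    by apply/sq_gt0/eqP.
  move: e; rewrite !conjcR => /esym e.
  exists (((m / nm (S v))%:C * (sq (S v))%:C * (m / nm (S v))%:C)^-1 *
    ((m / nm y)%:C * ip (S v) y * (m / nm y)%:C)).
  by rewrite -scalerA -{}e scalerA mulVf ?scale1r.
have ker w : ip w y = 0 -> val A w = 0.
  move=> wy; rewrite -SS (_ : S w = 0) ?(lin0 lS) //; apply/(sq0P ip).
  have [c hc] := par w; have [c' hc'] := par y.
  by rewrite /sq (positive_sa posS) hc (linZ lS) hc' !ipZr wy !mulr0.
have Aw := kernel_rank_one Su0 (cone_pos A) ker.
set k := qform (val A) y / sq y / sq y in Aw.
have kp : 0 <= k by rewrite !divr_ge0 ?sq_ge0 // (qform_ge0 (cone_form A)).
have Ax : A = ray ((Num.sqrt k)%:C *: y).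
  apply: cone_eq; apply/funext => w.
  rewrite Aw /= /rank_one ipZr !scalerA conjcR mulrC; congr (_ *: _).
  by rewrite mulrAC -rmorphM /= -expr2 sqr_sqrtr // mulrC.
by exists ((Num.sqrt k)%:C *: y) => // x0; apply: A0; rewrite Ax x0.
Qed.
End BuresMetric.

(** * Wigner's theorem *)

Section Wigner.
Context {R : realType} {H : completeNormedModType R[i]}.
Variable ip : {dot H for Num.conj}.
Local Notation nm := (nm ip).
Local Notation sq := (sq ip).
Implicit Types (x y z u v w : H) (c : R[i]).

(** The two continuous automorphisms of the complex numbers, so that unitary
    and antiunitary operators can be treated together. *)
Definition sigma (b : bool) c : R[i] := if b then c else c^*%R.

Lemma sigmaM b c d : sigma b (c * d) = sigma b c * sigma b d.
Proof. by case: b => //=; rewrite conjcM. Qed.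
Lemma sigmaD b c d : sigma b (c + d) = sigma b c + sigma b d.
Proof. by case: b => //=; rewrite rmorphD. Qed.
Lemma sigmaJ b c : sigma b (c^*%R) = (sigma b c)^*%R.
Proof. by case: b. Qed.
Lemma sigmaK b c : sigma b (sigma b c) = c.
Proof. by case: b => //=; rewrite conjCK. Qed.
Lemma normc_sigma b c : normc (sigma b c) = normc c.
Proof. by case: b => //=; rewrite normc_conj. Qed.

(** The case of equality in the Cauchy-Schwarz inequality, for vectors of equal
    norm. *)
Lemma cauchy_schwarz_eq x y : sq x = sq y -> normc (ip y x) = sq x ->
  exists2 c, normc c = 1 & y = c *: x.
Proof.
move=> xy yx; have [x0|/eqP x0] := eqVneq x 0.
  exists 1; rewrite ?Normc.normc1 // x0 scaler0; apply/(sq0P ip).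
  by rewrite -xy x0; apply/(sq0P ip).
have sx : 0 < sq x by apply/sq_gt0/eqP.
have nC : normc (sq x)%:C = sq x by rewrite normc_real gtr0_norm.
have n1 : normc (ip y x / (sq x)%:C) = 1.
  by rewrite Normc.normcM Normc.normcV nC yx divff ?gt_eqF.
exists (ip y x / (sq x)%:C) => //; apply/eqP; rewrite -subr_eq0.
apply/eqP/(sq0P ip); rewrite sqB sqZ n1 expr1n mul1r -xy ipZr.
have -> : (ip y x / (sq x)%:C)^*%R * ip y x = (sq x)%:C.
  rewrite mulrC -{1}[ip y x](divfK (_ : (sq x)%:C != 0)) ?fmorph_eq0 ?gt_eqF //.
  by rewrite mulrAC mulcJ n1 expr1n mul1r.
by rewrite /=; ring.
Qed.

Variable T : H -> H.
Hypothesis T_ip : forall x y, normc (ip (T x) (T y)) = normc (ip x y).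

Lemma sq_normc x : normc (ip x x) = sq x.
Proof. by rewrite ipxx normc_real ger0_norm ?sq_ge0. Qed.

Lemma T_sq x : sq (T x) = sq x.
Proof. by rewrite -!sq_normc T_ip. Qed.

Section UnitVector.
Variable e : H.
Hypothesis e1 : sq e = 1.

Let ortho u := ip u e = 0.

Let ipee : ip e e = 1.
Proof. by rewrite ipxx e1. Qed.

Let ipTee : ip (T e) (T e) = 1.
Proof. by rewrite ipxx T_sq e1. Qed.

Let orthoC u : ortho u -> ip e u = 0.
Proof. by rewrite /ortho ipC => h; rewrite ipC ipC h !conjC0. Qed.

Let orthoZ c u : ortho u -> ortho (c *: u).
Proof. by rewrite /ortho ipZl => ->; rewrite mulr0. Qed.

Let orthoD u v : ortho u -> ortho v -> ortho (u + v).
Proof. by rewrite /ortho ipDl => -> ->; rewrite addr0. Qed.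

(** On the orthogonal complement of [e], the phase of [T (e + u)] can be
    normalised by its product with [T e], and the result has the form
    [T e + V u].  As [V u] is a unit multiple of [T u], the map [V] preserves
    both [|<u,v>|] and [|1 + <u,v>|], hence the real part of [<u,v>]. *)
Lemma affine_chart : exists V : H -> H, forall u, ortho u ->
  [/\ ip (V u) (T e) = 0,
      exists2 c, normc c = 1 & T e + V u = c *: T (e + u) &
      exists2 c, normc c = 1 & V u = c *: T u].
Proof.
have /choice[N hN] : forall u, exists c, normc c = 1 /\
    c * ip (T (e + u)) (T e) = (normc (ip (T (e + u)) (T e)))%:C.
  by move=> u; have [c ? ?] := phase_exists (ip (T (e + u)) (T e)); exists c.
exists (fun u => N u *: T (e + u) - T e) => u ue.
have [n1 nu] := hN u; set x := N u *: T (e + u) in nu *.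
have xe : ip x (T e) = 1.
  by rewrite ipZl nu T_ip ipDl ipee ue addr0 Normc.normc1.
have Ve : ip (x - T e) (T e) = 0 by rewrite ipDl ipNl xe ipTee subrr.
split=> //; first by exists (N u) => //; rewrite addrC subrK.
have sqx : sq x = 1 + sq u.
  by rewrite sqZ n1 expr1n mul1r T_sq sqD e1 orthoC //= mulr0 addr0.
have Tue : ip (T e) (T u) = 0.
  by apply/eqP; rewrite -normc_eq0 T_ip orthoC // Normc.normc0.
apply: cauchy_schwarz_eq.
  rewrite T_sq; have := sqx; rewrite -[x in sq x](subrK (T e)) sqD Ve T_sq e1 /=.
  lra.
rewrite ipDl ipNl Tue subr0 ipZl Normc.normcM n1 mul1r T_ip ipDl orthoC //.
by rewrite add0r sq_normc T_sq.
Qed.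

Lemma normc_add1 c : normc (1 + c) ^+ 2 = 1 + 2 * Re c + normc c ^+ 2.
Proof. by rewrite !normc_sqr !ReIm /=; ring. Qed.

(** Preservation of the real part of the inner product makes [V] additive and
    real linear.  It also leaves only [V (iu) = iVu] or [V (iu) = - iVu], and
    the sign is the same for all [u]. *)
Lemma wigner_complement : exists b (V : H -> H),
  [/\ forall c u v, ortho u -> ortho v -> V (c *: u + v) = sigma b c *: V u + V v,
      forall u v, ortho u -> ortho v -> ip (V u) (V v) = sigma b (ip u v),
      forall u, ortho u -> ip (V u) (T e) = 0,
      forall u, ortho u -> exists2 c, normc c = 1 & T e + V u = c *: T (e + u) &
      forall u, ortho u -> exists2 c, normc c = 1 & V u = c *: T u].
Proof.
have [V hV] := affine_chart.
have Ve u : ortho u -> ip (V u) (T e) = 0 by move=> /hV[].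
have eV u : ortho u -> ip (T e) (V u) = 0.
  by move=> /Ve h; rewrite ipC h conjC0.
have V_abs u v : ortho u -> ortho v -> normc (ip (V u) (V v)) = normc (ip u v).
  move=> /hV[_ _ [c c1 ->]] /hV[_ _ [d d1 ->]].
  by rewrite ipZl ipZr !Normc.normcM normc_conj c1 d1 !mul1r T_ip.
have V_re u v : ortho u -> ortho v -> Re (ip (V u) (V v)) = Re (ip u v).
  move=> ou ov; have h := V_abs _ _ ou ov.
  have [_ [c c1 hc] _] := hV _ ou; have [_ [d d1 hd] _] := hV _ ov.
  have : normc (ip (T e + V u) (T e + V v)) = normc (ip (e + u) (e + v)).
    by rewrite hc hd ipZl ipZr !Normc.normcM normc_conj c1 d1 !mul1r T_ip.
  rewrite !ipDl !ipDr ipTee ipee Ve // eV // (orthoC ov) ou !addr0 !add0r.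
  move=> /(congr1 (fun r => r ^+ 2)); rewrite !normc_add1 h; lra.
have V_sq u : ortho u -> sq (V u) = sq u by move=> ou; exact: V_re.
have VD u v : ortho u -> ortho v -> V (u + v) = V u + V v.
  move=> ou ov; have ouv := orthoD ou ov.
  apply/eqP; rewrite -subr_eq0; apply/eqP/(sq0P ip).
  rewrite sqB sqD !V_sq // ipDr cReD !V_re // sqD ipDl ipDl !cReD.
  rewrite -/(sq u) -/(sq v) (ipC ip u v) cReJ; ring.
have VZr (a : R) u : ortho u -> V (a%:C *: u) = a%:C *: V u.
  move=> ou; have oau := orthoZ a%:C ou.
  apply/eqP; rewrite -subr_eq0; apply/eqP/(sq0P ip).
  rewrite sqB sqZ !V_sq // sqZ normc_real real_normK ?num_real //.
  by rewrite ipZr conjcR cReM V_re // ipZl ipxx !cReM /=; ring.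
have VN u : ortho u -> V (- u) = - V u.
  move=> ou; have := VZr (-1) u ou.
  by rewrite rmorphN1 !scaleN1r.
have Vi u : ortho u -> V ('i *: u) = 'i *: V u \/ V ('i *: u) = - ('i *: V u).
  move=> ou; have oiu := orthoZ 'i ou.
  have i1 : normc 'i = 1 :> R by rewrite /= expr0n add0r expr1n sqrtr1.
  have re0 : Re (ip (V ('i *: u)) (V u)) = 0.
    by rewrite V_re // ipZl ipxx cReM /=; ring.
  have : Im (ip (V ('i *: u)) (V u)) ^+ 2 = sq u ^+ 2.
    have := V_abs _ _ oiu ou; rewrite ipZl Normc.normcM i1 mul1r sq_normc => <-.
    by rewrite normc_sqr re0 expr0n add0r.
  move=> /eqP; rewrite eqf_sqr => /orP[] /eqP im; [left|right]; apply/eqP.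
    rewrite -subr_eq0; apply/eqP/(sq0P ip).
    by rewrite sqB sqZ i1 !V_sq // sqZ i1 ipZr cReM cReJ cImJ /= im; ring.
  rewrite -addr_eq0; apply/eqP/(sq0P ip).
  by rewrite sqD sqZ i1 !V_sq // sqZ i1 ipZr cReM cReJ cImJ /= im; ring.
(* A group is not the union of two proper subgroups. *)
have [b Vib] : exists b, forall u, ortho u -> V ('i *: u) = sigma b 'i *: V u.
  have [h|/existsNP[u /not_implyP[ou nu]]] :=
    pselect (forall u, ortho u -> V ('i *: u) = 'i *: V u); first by exists true.
  exists false => v ov; rewrite [sigma _ _](_ : _ = - 'i); last first.
    by apply: complex_ext; rewrite /= ?oppr0.
  rewrite scaleNr; have [vi|//] := Vi v ov.
  have [//|ui] := Vi u ou.
  have := Vi _ (orthoD ou ov); rewrite scalerDr (VD _ _ ou ov).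
  rewrite (VD _ _ (orthoZ 'i ou) (orthoZ 'i ov)) ui vi.
  rewrite scalerDr opprD => -[/addIr|/addrI] h //.
  by case: nu; rewrite ui.
have i_split c : c = (Re c)%:C + (Im c)%:C * 'i.
  by apply: complex_ext; rewrite !ReIm /=; ring.
have VZ c u : ortho u -> V (c *: u) = sigma b c *: V u.
  move=> ou; rewrite {1}[c]i_split scalerDl -scalerA.
  have oiu := orthoZ 'i ou.
  rewrite (VD _ _ (orthoZ _ ou) (orthoZ _ oiu)) !VZr // Vib //.
  rewrite scalerA -scalerDl; congr (_ *: _).
  by case: (b) => /=; apply: complex_ext; rewrite !ReIm /=; ring.
exists b, V; split.
- by move=> c u v ou ov; rewrite (VD _ _ (orthoZ c ou) ov) VZ.
- move=> u v ou ov; apply: complex_ext.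
    by rewrite V_re //; case: (b); rewrite //= cReJ.
  have := V_re _ _ (orthoZ 'i ou) ov; rewrite Vib // !ipZl.
  case: (b) => /=; rewrite !ReIm /=; lra.
- exact: Ve.
- by move=> u /hV[].
- by move=> u /hV[].
Qed.

(** Extend [V] to the whole space by [e |-> T e].  A vector [x] that is not
    orthogonal to [e] is a multiple of some [e + u], and [T] maps proportional
    vectors to proportional ones. *)
Lemma wigner_unit : exists b (U : H -> H),
  [/\ forall c x y, U (c *: x + y) = sigma b c *: U x + U y,
      forall x y, ip (U x) (U y) = sigma b (ip x y) &
      forall x, exists2 c, normc c = 1 & T x = c *: U x].
Proof.
have [b [V [V_lin V_ip Ve V_aff V_ray]]] := wigner_complement.
pose q x := x - ip x e *: e.
have oq x : ortho (q x) by rewrite /ortho /q ipDl ipNl ipZl ipee mulr1 subrr.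
have eV u : ortho u -> ip (T e) (V u) = 0.
  by move=> /Ve h; rewrite ipC h conjC0.
pose U x := sigma b (ip x e) *: T e + V (q x).
have U_lin c x y : U (c *: x + y) = sigma b c *: U x + U y.
  rewrite /U (_ : q (c *: x + y) = c *: q x + q y); last first.
    rewrite /q ipDl ipZl scalerBr scalerDl scalerA opprD.
    by rewrite !addrA; congr (_ + _); rewrite addrAC.
  rewrite V_lin // ipDl ipZl sigmaD sigmaM scalerDl scalerDr scalerA.
  by rewrite addrACA.
have U_ip x y : ip (U x) (U y) = sigma b (ip x y).
  rewrite /U !ipDl !ipDr !ipZl !ipZr ipTee Ve // eV // V_ip // !mulr0 addr0 add0r.
  rewrite mulr1 -sigmaJ -sigmaM -sigmaD; congr sigma.
  rewrite /q !ipE ipee -(ipC ip); ring.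
have U_sq x : sq (U x) = sq x.
  by rewrite -!sq_normc U_ip normc_sigma.
exists b, U; split=> // x.
apply: cauchy_schwarz_eq; first by rewrite U_sq T_sq.
rewrite U_sq; have [xe|xe] := eqVneq (ip x e) 0.
  have [c c1 hc] := V_ray (q x) (oq x).
  have qx : q x = x by rewrite /q xe scale0r subr0.
  have -> : U x = c *: T x.
    by rewrite /U hc qx xe; case: (b); rewrite /= ?conjC0 scale0r add0r.
  by rewrite ipZr Normc.normcM normc_conj c1 mul1r T_ip sq_normc.
pose l := (ip x e)^-1.
have [c c1 hc] := V_aff (l *: q x) (orthoZ l (oq x)).
have lx : e + l *: q x = l *: x.
  by rewrite /q scalerBr scalerA mulVf // scale1r addrC subrK.
have V0 : V 0 = 0.
  apply/(sq0P ip); rewrite -sq_normc V_ip ?ip0l /ortho ?ip0l //.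
  by rewrite normc_sigma Normc.normc0.
have -> : U x = (sigma b (ip x e) * c) *: T (l *: x).
  rewrite -scalerA -lx -hc scalerDr /U; congr (_ + _).
  have := V_lin l (q x) 0 (oq x); rewrite /ortho ip0l V0 !addr0 => -> //.
  by rewrite scalerA -sigmaM mulfV //; case: (b); rewrite /= ?conjC1 scale1r.
rewrite ipZr Normc.normcM normc_conj Normc.normcM c1 mulr1 normc_sigma T_ip.
rewrite ipZr Normc.normcM normc_conj sq_normc mulrA -Normc.normcM mulfV //.
by rewrite Normc.normc1 mul1r.
Qed.

End UnitVector.

Theorem wigner : exists b (U : H -> H),
  [/\ forall c x y, U (c *: x + y) = sigma b c *: U x + U y,
      forall x y, ip (U x) (U y) = sigma b (ip x y) &
      forall x, exists2 c, normc c = 1 & T x = c *: U x].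
Proof.
have [[x x0]|/forallNP H0] := pselect (exists x : H, x <> 0).
  apply: (@wigner_unit (((nm x)^-1)%:C *: x)).
  rewrite sqZ normc_real ger0_norm ?invr_ge0 ?nm_ge0 // exprVn nm_sqr mulVf //.
  by rewrite gt_eqF // sq_gt0 //; apply/eqP.
have {}H0 x : x = 0 by apply: contrapT; exact: H0.
exists true, id; split=> // x; exists 1; first exact: Normc.normc1.
by rewrite (H0 (T x)) (H0 x) scaler0.
Qed.

End Wigner.

(** * Bures isometries *)

Section Isometries.
Context {R : realType} {H : completeNormedModType R[i]}.
Variable ip : {dot H for Num.conj}.
Hypothesis ip_norm : forall x : H, `|x| ^+ 2 = ip x x.
Local Notation nm := (nm ip).
Local Notation sq := (sq ip).
Local Notation qform := (qform ip).
Local Notation tr := (tr ip).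
Local Notation dist := (bures_distance ip).
Local Notation cone := (positive_trace_class ip).
Local Notation ray := (ray ip_norm).
Local Notation overlap := (@overlap _ _ ip).
Implicit Types (A B C : cone) (x y z w u : H).

Lemma overlap_rays x y : overlap (ray x) (ray y) = 2 * normc (ip x y).
Proof.
by rewrite overlap_ray_l qform_rank_one sqrtr_sqr ger0_norm ?normc_ge0.
Qed.

Lemma ray_eq x y : ray x = ray y -> exists2 c, normc c = 1 & y = c *: x.
Proof.
move=> xy; apply: (@cauchy_schwarz_eq _ _ ip).
  by rewrite -!(tr_ray ip_norm) xy.
have := overlap_rays y x; rewrite -xy overlap_rays sq_normc => h; lra.
Qed.

(** Polarisation recovers the real part of [<fx,u>] from the form, and the
    imaginary part is a real part at [iu]. *)
Lemma qform_inj (f g : H -> H) : linear f -> linear g ->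
  (forall x, 0 <= ip (f x) x) -> (forall x, 0 <= ip (g x) x) ->
  (forall x, qform f x = qform g x) -> f = g.
Proof.
move=> lf lg pf pg fg; apply/funext => x; apply: (ip_left_inj (ip := ip)) => y.
have polar (h : H -> H) u : linear h -> (forall x, 0 <= ip (h x) x) ->
    2 * Re (ip (h x) u) = qform h (x + u) - qform h x - qform h u.
  move=> lh ph; rewrite /qform (linD lh) !ipE !cReD.
  rewrite (positive_selfadjoint lh ph u x) (ipC ip (h x) u) cReJ; ring.
have re u : Re (ip (f x) u) = Re (ip (g x) u).
  by have := polar f u lf pf; rewrite !fg -(polar g u lg pg); lra.
apply: complex_ext; first exact: re.
by have := re ('i *: y); rewrite !ipZr !ReIm /=; lra.
Qed.

Section Preservation.
Variables f g : cone -> cone.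
Hypotheses (fK : cancel f g) (gK : cancel g f).
Hypothesis f_dist : forall A B, dist (val (f A)) (val (f B)) = dist (val A) (val B).

Lemma inverse_dist A B : dist (val (g A)) (val (g B)) = dist (val A) (val B).
Proof. by rewrite -f_dist !gK. Qed.

Lemma isometry_zero : f (ray 0) = ray 0.
Proof.
apply: contrapT => /nonzero_midpoint[B [C [[m1 m2] BC]]]; apply: BC.
have d0 D : dist (val (ray 0)) (val (g D)) = dist (val (f (ray 0))) (val D).
  by rewrite -f_dist gK.
have gBC : g B = g C.
  by apply: (@zero_not_midpoint _ _ _ ip_norm); split; rewrite inverse_dist d0.
by rewrite -(gK B) gBC gK.
Qed.

Lemma isometry_tr A : tr (val (f A)) = tr (val A).
Proof. by rewrite !(tr_dist0 ip_norm) -{1}isometry_zero f_dist. Qed.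

Lemma isometry_overlap A B : overlap (f A) (f B) = overlap A B.
Proof. by rewrite /overlap !isometry_tr f_dist. Qed.

Lemma isometry_dominated A B : dominated B (f A) -> dominated (g B) A.
Proof.
by move=> BA C; have := BA (f C); rewrite -{1}(gK B) !isometry_overlap.
Qed.

Lemma isometry_is_ray A : is_ray ip_norm A -> is_ray ip_norm (f A).
Proof.
move=> [A0 A_dom]; split=> [fA|B B' BA B'A BB'].
  by apply: A0; apply: (can_inj fK); rewrite fA isometry_zero.
apply: (can_inj gK); apply: A_dom; try exact: isometry_dominated.
by rewrite -(isometry_tr (g B)) -(isometry_tr (g B')) !gK.
Qed.

Lemma isometry_ray x : exists y, f (ray x) = ray y.
Proof.
have [->|/eqP x0] := eqVneq x 0; first by exists 0; exact: isometry_zero.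
by have /isometry_is_ray/is_rayP[y _ ->] := ray_is_ray ip_norm x0; exists y.
Qed.

End Preservation.

(** The isometry acts on rank one operators through a map [T] of vectors that
    preserves the moduli of inner products, and Wigner's theorem replaces [T]
    by [U].  The overlaps with rank one operators show that the quadratic form
    of [f A] at [U x] is that of [A] at [x]. *)
Lemma isometry_implemented (f : cone -> cone) : bijective f ->
  (forall A B, dist (val (f A)) (val (f B)) = dist (val A) (val B)) ->
  exists b (U V : H -> H),
  [/\ forall c x y, U (c *: x + y) = sigma b c *: U x + U y,
      forall x y, ip (U x) (U y) = sigma b (ip x y),
      cancel U V, cancel V U &
      forall A, val (f A) = U \o val A \o V].
Proof.
move=> [g fK gK] f_dist.
have [T fT] := choice (isometry_ray fK gK f_dist).
have T_ip x y : normc (ip (T x) (T y)) = normc (ip x y).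
  have := isometry_overlap gK f_dist (ray x) (ray y).
  by rewrite !fT !overlap_rays => /mulfI ->.
have [b [U [U_lin U_ip TU]]] := wigner T_ip.
have U_sq x : sq (U x) = sq x by rewrite -!sq_normc U_ip normc_sigma.
have U0 : U 0 = 0 by apply/(sq0P ip); rewrite U_sq; apply/(sq0P ip).
have UZ c x : U (c *: x) = sigma b c *: U x.
  by have := U_lin c x 0; rewrite U0 !addr0.
have U_surj y : exists x, U x = y.
  have [x gx] := isometry_ray gK fK (inverse_dist gK f_dist) y.
  have [d _ yd] : exists2 d, normc d = 1 & y = d *: T x.
    by apply: ray_eq; rewrite -fT -gx gK.
  have [c _ xc] := TU x; exists (sigma b (d * c) *: x).
  by rewrite UZ sigmaK yd xc scalerA.
have [V UV] := choice U_surj.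
have VU x : V (U x) = x.
  apply/eqP; rewrite -subr_eq0; apply/eqP/(sq0P ip).
  have -> : V (U x) - x = (-1) *: x + V (U x) by rewrite scaleN1r addrC.
  have sN : sigma b (-1) = -1 :> R[i] by case: (b); rewrite //= rmorphN1.
  by rewrite -U_sq U_lin UV sN scaleN1r addNr; apply/(sq0P ip).
exists b, U, V; split=> // A.
have fA_U x : qform (val (f A)) (U x) = qform (val A) x.
  have [c c1 Tc] := TU x.
  have := isometry_overlap gK f_dist (ray x) A.
  rewrite fT !overlap_ray_l => h; have {h} : Num.sqrt (qform (val (f A)) (T x)) =
    Num.sqrt (qform (val A) x) by lra.
  move=> /(congr1 (fun r => r ^+ 2)).
  rewrite !sqr_sqrtr ?(qform_ge0 (cone_form ip_norm _)) // => <-; rewrite Tc.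
  rewrite /qform (linZ (cone_lin ip_norm _)) ipZl ipZr mulrA mulcJ c1 expr1n mul1r.
  by [].
have lA := cone_lin ip_norm A; have lfA := cone_lin ip_norm (f A).
have ip_V y x : ip (V y) x = sigma b (ip y (U x)).
  by rewrite -[y in RHS]UV U_ip sigmaK.
have V_lin c x y : V (sigma b c *: x + y) = c *: V x + V y.
  by rewrite -[LHS]VU -[RHS]VU U_lin !UV.
have conj_lin : linear (V \o val (f A) \o U).
  by move=> c x y; rewrite /= U_lin lfA V_lin.
have sigma_form x : sigma b (ip (val (f A) (U x)) (U x)) = (qform (val A) x)%:C.
  rewrite (ip_qform (cone_form ip_norm (f A))) fA_U; case: (b) => //=.
  exact: conjcR.
have conj_form x : 0 <= ip ((V \o val (f A) \o U) x) x.
  by rewrite /= ip_V sigma_form ler0c (qform_ge0 (cone_form ip_norm A)).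
have <- : V \o val (f A) \o U = val A.
  apply: qform_inj => // [x|x]; first exact: cone_form ip_norm A x.
  by rewrite /qform /= ip_V sigma_form.
by apply/funext => x; rewrite /= !UV.
Qed.

End Isometries.

Theorem theorem1 (R : realType) (H : completeNormedModType R[i])
    (ip : {dot H for Num.conj}) (ip_norm : forall x : H, `|x| ^+ 2 = ip x x)
    (phi : positive_trace_class ip -> positive_trace_class ip)
    (phi_bij : bijective phi)
    (phi_bures : forall A B : positive_trace_class ip,
       bures_distance ip (val (phi A)) (val (phi B)) =
       bures_distance ip (val A) (val B)) :
  (exists2 U : H -> H, unitary ip U &
     forall A : positive_trace_class ip,
       val (phi A) = U \o val A \o adjoint ip U) \/
  (exists2 U : H -> H, antiunitary ip U &
     forall A : positive_trace_class ip,
       val (phi A) = U \o val A \o antiunitary_adjoint U).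
Proof.
have [b [U [V [U_lin U_ip UK VK phiE]]]] :=
  isometry_implemented ip_norm phi_bij phi_bures.
case: b U_lin U_ip => U_lin U_ip; [left|right]; exists U.
- have adjU : adjoint ip U = V.
    by apply: adjoint_eq => x y; rewrite -{1}[y]VK U_ip.
  split; rewrite ?adjU; [|exact/funext|exact/funext].
  apply/(bounded_operatorP ip_norm); split=> //; exists 1 => // x.
  by rewrite mul1r /nm /sq U_ip.
- move=> A; rewrite phiE; congr (_ \o _); apply/esym.
  by apply: adjoint_eq => x y; rewrite -{1}[y]VK U_ip.
- split=> //; first exact: Bijective UK VK.
- move=> A; rewrite phiE; congr (_ \o _); apply/funext => y.
  rewrite -{2}[y]VK /antiunitary_adjoint pinvKV // ?inE //.
  by move=> u v _ _; exact: can_inj UK _ _.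
Qed.
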